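(* Let $n$ be a positive integer, let $A,A_d\in\mathbb{R}^{n\times n}$, and let $h_1\le h_2$ be positive integers. With the matrices $\tilde R_2$, $\Pi_0(h)$, $\Pi_1,\dots,\Pi_6$ defined in the context, assume that there exist symmetric positive definite matrices $P\in\mathbb{R}^{4n\times 4n}$ and $Q_i,R_i,S_i\in\mathbb{R}^{n\times n}$, $i=1,2$, and a matrix $X\in\mathbb{R}^{3n\times 3n}$ such that $$\begin{bmatrix}\tilde R_2 & X\\ X^T & \tilde R_2\end{bmatrix}\ge 0$$ and, for both $h=h_1$ and $h=h_2$, $$\Pi(h)=\Pi_0(h)+\Pi_1+\Pi_2-\Pi_3-\Pi_4-\Pi_5-\Pi_6<0 .$$ Then the system $$x(k+1)=Ax(k)+A_d\,x(k-h(k)),\quad k\ge 0,\qquad x(k)=\phi(k),\quad k\in\{-h_2,\dots,0\},$$ with state $x(k)\in\mathbb{R}^n$, is asymptotically stable for any time-varying (integer-valued) delay $h(k)$ satisfying $h_1\le h(k)\le h_2$ for all $k$.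
   Context: Notation. For symmetric matrices, $M<0$ means negative definite and $M\ge0$ means positive semidefinite. $\mathrm{col}\{\cdot\}$ stacks blocks vertically; $\mathrm{diag}\{\cdot\}$ is block diagonal; for a square matrix $M$, $\mathtt{He}(M)=M+M^T$. Put $h_{12}=h_2-h_1$, $T(h)=h+1$, $\gamma(h)=\frac{T(h)T(h+1)}{2}=\frac{(h+1)(h+2)}{2}$. Let $e_1^*,\dots,e_{10}^*$ be the standard row basis of $\mathbb{R}^{10}$ and $e_i=e_i^*\otimes I_n\in\mathbb{R}^{n\times 10n}$. Put $\mathcal{A}=(A-I_n)e_1+A_de_3$. Define $\Omega(h)=\mathrm{col}\{e_1,\ T(h_1)e_5,\ T(h-h_1)e_6+T(h_2-h)e_7,\ \gamma(h_1)e_8\}$, $\Omega_1=\mathrm{col}\{-\mathcal{A},\ e_2,\ e_3+e_4,\ T(h_1)e_5\}$, $\Omega_2=\mathrm{col}\{0,\ e_1,\ e_2+e_3,\ T(h_1)e_1\}$ (here $0$ is the $n\times 10n$ zero matrix), $\Gamma_1=\mathrm{col}\{e_1-e_2,\ e_1+e_2-2e_5,\ e_1-e_2+6e_5-6e_8\}$, $\Gamma_2=\mathrm{col}\{e_2-e_3,\ e_2+e_3-2e_6,\ e_2-e_3+6e_6-6e_9\}$, $\Gamma_3=\mathrm{col}\{e_3-e_4,\ e_3+e_4-2e_7,\ e_3-e_4+6e_7-6e_{10}\}$, $\Gamma_4=\mathrm{col}\{e_2-e_5,\ e_2-4e_5+3e_8\}$, $\Gamma_5=\mathrm{col}\{e_3-e_6,\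 e_4-e_7\}$, $\Gamma_6=\mathrm{col}\{e_3-4e_6+3e_9,\ e_4-4e_7+3e_{10}\}$. Constants: if $h_1=1$, then $c_1(h_1)=c_2(h_1)=c_3(h_1)=1$; if $h_1>1$, then $c_1(h_1)=\frac{h_1+1}{h_1-1}$, $c_2(h_1)=\frac{(h_1+1)(h_1+2)^2}{(h_1-1)(h_1^2+11)}$, $c_3(h_1)=\frac{h_1+2}{h_1-1}$. For given $P,Q_i,R_i,S_i,X$ define $\tilde R_1(h_1)=\mathrm{diag}\{R_1,\ 3c_1(h_1)R_1,\ 5c_2(h_1)R_1\}$, $\tilde R_2=\mathrm{diag}\{R_2,3R_2,5R_2\}$, $\hat S_1(h_1)=\mathrm{diag}\{S_1,\ 2c_3(h_1)S_1\}$, $\hat S_2=\mathrm{diag}\{S_2,S_2\}$, and $\Pi_0(h)=\mathtt{He}\big(\Omega(h)^TP(\Omega_2-\Omega_1)\big)+\Omega_1^TP\Omega_1-\Omega_2^TP\Omega_2$, $\Pi_1=e_1^TQ_1e_1-e_2^TQ_1e_2+e_2^TQ_2e_2-e_4^TQ_2e_4$, $\Pi_2=\mathcal{A}^T\big[h_1^2R_1+h_{12}^2R_2+\gamma(h_1-1)S_1+\gamma(h_{12}-1)S_2\big]\mathcal{A}$, $\Pi_3=\Gamma_1^T\tilde R_1(h_1)\Gamma_1$, $\Pi_4=\begin{bmatrix}\Gamma_2\\ \Gamma_3\end{bmatrix}^T\begin{bmatrix}\tilde R_2&X\\ X^T&\tilde R_2\end{bmatrix}\begin{bmatrix}\Gamma_2\\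 \Gamma_3\end{bmatrix}$, $\Pi_5=\frac{2(h_1+1)}{h_1}\Gamma_4^T\hat S_1(h_1)\Gamma_4$, $\Pi_6=2\Gamma_5^T\hat S_2\Gamma_5+4\Gamma_6^T\hat S_2\Gamma_6$. Asymptotic stability of the system refers to asymptotic stability of its zero solution. *)

(* Defs.v *)
From mathcomp Require Import all_boot all_order all_algebra.
From mathcomp Require Import mxtens.
From mathcomp Require Import all_classical all_reals all_analysis.

Set Implicit Arguments.
Unset Strict Implicit.
Unset Printing Implicit Defensive.

Import Order.TTheory GRing.Theory Num.Theory.
Import numFieldNormedType.Exports.

Local Open Scope classical_set_scope.
Local Open Scope ring_scope.

Section Definiteness.
Variables (R : realType) (m : nat).
Implicit Type M : 'M[R]_m.

(* The quadratic form v^T M v is a 1 x 1 matrix, hence the entry "0 0". *)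
Definition qform M (v : 'cV[R]_m) : R := (v^T *m M *m v) 0 0.

Definition posdefmx M :=
  M \is symmetricmx /\ forall v : 'cV[R]_m, v != 0 -> 0 < qform M v.

Definition possemidefmx M :=
  M \is symmetricmx /\ forall v : 'cV[R]_m, 0 <= qform M v.

Definition negdefmx M :=
  M \is symmetricmx /\ forall v : 'cV[R]_m, v != 0 -> qform M v < 0.

Definition He M : 'M[R]_m := M + M^T.

End Definiteness.

Section Blocks.
Variables (R : realType) (n p : nat).

Definition col3 (a b c : 'M[R]_(n, p)) : 'M[R]_(n + (n + n), p) :=
  col_mx a (col_mx b c).

Definition col4 (a b c d : 'M[R]_(n, p)) : 'M[R]_(n + (n + (n + n)), p) :=
  col_mx a (col_mx b (col_mx c d)).

Definition diag2 (a b : 'M[R]_n) : 'M[R]_(n + n) := block_mx a 0 0 b.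

Definition diag3 (a b c : 'M[R]_n) : 'M[R]_(n + (n + n)) :=
  block_mx a 0 0 (block_mx b 0 0 c).

End Blocks.

(* The arguments of all scalar functions below are real numbers: in
   particular gamma (h12 - 1) = gamma (-1) = 0 when h1 = h2, which the
   truncated subtraction of nat would turn into gamma 0 = 1. *)
Section Scalars.
Variable R : realType.
Implicit Type h : R.

Definition T h : R := h + 1.

Definition gamma h : R := T h * T (h + 1) / 2.

Definition c1 h : R := if h == 1 then 1 else (h + 1) / (h - 1).

Definition c2 h : R :=
  if h == 1 then 1
  else ((h + 1) * (h + 2) ^+ 2) / ((h - 1) * (h ^+ 2 + 11)).

Definition c3 h : R := if h == 1 then 1 else (h + 2) / (h - 1).

End Scalars.

(* e_i^* (x) I_n, with the index i running from 1 to 10; the cast only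
   identifies the number of rows 1 * n with n. *)
Definition e (R : realType) (n i : nat) : 'M[R]_(n, 10 * n) :=
  castmx (mul1n n, erefl (10 * n)%N)
    ((delta_mx 0 (inord i.-1) : 'rV[R]_10) *t (1%:M : 'M[R]_n)).

Section LMI.
Variables (R : realType) (n : nat) (A Ad : 'M[R]_n) (h1 h2 : R).
Variables (P : 'M[R]_(n + (n + (n + n)))) (Q1 Q2 R1 R2 S1 S2 : 'M[R]_n).
Variable X : 'M[R]_(n + (n + n)).

Local Notation E i := (e R n i).

Definition h12 : R := h2 - h1.

Definition calA : 'M[R]_(n, 10 * n) := (A - 1%:M) *m (E 1) + Ad *m (E 3).

Definition Omega (h : R) :=
  col4 (E 1) (T h1 *: (E 5)) (T (h - h1) *: (E 6) + T (h2 - h) *: (E 7))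
       (gamma h1 *: (E 8)).
Definition Omega1 := col4 (- calA) (E 2) ((E 3) + (E 4)) (T h1 *: (E 5)).
Definition Omega2 := col4 0 (E 1) ((E 2) + (E 3)) (T h1 *: (E 1)).

Definition Gamma1 :=
  col3 ((E 1) - (E 2)) ((E 1) + (E 2) - 2 *: (E 5))
       ((E 1) - (E 2) + 6 *: (E 5) - 6 *: (E 8)).
Definition Gamma2 :=
  col3 ((E 2) - (E 3)) ((E 2) + (E 3) - 2 *: (E 6))
       ((E 2) - (E 3) + 6 *: (E 6) - 6 *: (E 9)).
Definition Gamma3 :=
  col3 ((E 3) - (E 4)) ((E 3) + (E 4) - 2 *: (E 7))
       ((E 3) - (E 4) + 6 *: (E 7) - 6 *: (E 10)).
Definition Gamma4 := col_mx ((E 2) - (E 5)) ((E 2) - 4 *: (E 5) + 3 *: (E 8)).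
Definition Gamma5 := col_mx ((E 3) - (E 6)) ((E 4) - (E 7)).
Definition Gamma6 :=
  col_mx ((E 3) - 4 *: (E 6) + 3 *: (E 9)) ((E 4) - 4 *: (E 7) + 3 *: (E 10)).

Definition Rtilde1 := diag3 R1 ((3 * c1 h1) *: R1) ((5 * c2 h1) *: R1).
Definition Rtilde2 := diag3 R2 (3 *: R2) (5 *: R2).
Definition Shat1 := diag2 S1 ((2 * c3 h1) *: S1).
Definition Shat2 := diag2 S2 S2.

Definition Rtilde2X : 'M[R]_((n + (n + n)) + (n + (n + n))) :=
  block_mx Rtilde2 X X^T Rtilde2.

Definition Pi0 (h : R) : 'M[R]_(10 * n) :=
  He ((Omega h)^T *m P *m (Omega2 - Omega1))
  + Omega1^T *m P *m Omega1 - Omega2^T *m P *m Omega2.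

Definition Pi1 : 'M[R]_(10 * n) :=
  (E 1)^T *m Q1 *m (E 1) - (E 2)^T *m Q1 *m (E 2)
  + (E 2)^T *m Q2 *m (E 2) - (E 4)^T *m Q2 *m (E 4).

Definition Pi2 : 'M[R]_(10 * n) :=
  calA^T *m (h1 ^+ 2 *: R1 + h12 ^+ 2 *: R2
             + gamma (h1 - 1) *: S1 + gamma (h12 - 1) *: S2) *m calA.

Definition Pi3 : 'M[R]_(10 * n) := Gamma1^T *m Rtilde1 *m Gamma1.

Definition Pi4 : 'M[R]_(10 * n) :=
  (col_mx Gamma2 Gamma3)^T *m Rtilde2X *m col_mx Gamma2 Gamma3.

Definition Pi5 : 'M[R]_(10 * n) :=
  (2 * (h1 + 1) / h1) *: (Gamma4^T *m Shat1 *m Gamma4).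

Definition Pi6 : 'M[R]_(10 * n) :=
  2 *: (Gamma5^T *m Shat2 *m Gamma5) + 4 *: (Gamma6^T *m Shat2 *m Gamma6).

Definition Pi (h : R) : 'M[R]_(10 * n) :=
  Pi0 h + Pi1 + Pi2 - Pi3 - Pi4 - Pi5 - Pi6.

End LMI.

Section System.
Variables (R : realType) (n : nat) (A Ad : 'M[R]_n) (h2 : nat) (h : nat -> nat).

(* Time is int, so that k - h k is a genuine subtraction; only the values of
   phi on {-h2, ..., 0} and of x on {-h2, -h2 + 1, ...} matter. *)
Definition is_solution (phi x : int -> 'cV[R]_n) :=
  (forall k : int, - h2%:Z <= k <= 0 -> x k = phi k) /\
  (forall k : nat, x (k%:Z + 1) = A *m x k%:Z + Ad *m x (k%:Z - (h k)%:Z)).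

Definition initial_lt (phi : int -> 'cV[R]_n) (delta : R) :=
  forall k : int, - h2%:Z <= k <= 0 -> `|phi k| < delta.

Definition zero_stable :=
  forall eps : R, 0 < eps -> exists2 delta : R, 0 < delta &
    forall phi x, is_solution phi x -> initial_lt phi delta ->
      forall k : nat, `|x k%:Z| < eps.

Definition zero_attractive :=
  exists2 delta : R, 0 < delta &
    forall phi x, is_solution phi x -> initial_lt phi delta ->
      (fun k : nat => x k%:Z) @ \oo --> (0 : 'cV[R]_n).

Definition asymptotically_stable := zero_stable /\ zero_attractive.

End System.

(* Main.v *)
Require Import Defs.
From mathcomp Require Import all_boot all_order all_algebra.
From mathcomp Require mxtens.
From mathcomp Require Import all_classical all_reals all_analysis.
From mathcomp Require Import ring lra zify.
Import Order.TTheory GRing.Theory Num.Theory.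
Import numFieldNormedType.Exports.
Local Open Scope ring_scope.

(** The state of the delay equation at time [k] is its history
    [H j = x (k - j)], and a quadratic functional [lyapunov] of the history
    decreases along every step. It is the sum of a form [P] in [H 0], two
    windowed sums and a double sum of past values ([augmented]), of windowed sums
    of the forms [Q1], [Q2], and of iterated windowed sums of the forms [R1],
    [R2], [S1], [S2] in the increments [decr H j].

    Over one step a windowed sum gains its newest term and loses its oldest
    one. The change of the functional is therefore an explicit form in ten
    vectors (the values of the history at the lags 0, [h1], [h k], [h2], and the
    averages [avg1], [avg2] of the history over the three intervals between
    them), minus weighted sums over these intervals of forms in the increments.
    Endpoints and averages are themselves sums of increments against discrete
    orthogonal polynomials, so Bessel's inequality ([bessel]) bounds the sums of
    increments below by forms in the ten vectors: [summation_ineq3] for the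
    constant weight, [weighted_summation_ineq2] for the linear one. The lag
    [h k] cuts the interval from [h1] to [h2] in two pieces of varying lengths,
    and [reciprocally_convex] removes these lengths from the estimate. What
    results ([lyapunov_step]) is that the functional changes by at most the
    form [Pi (h k)] at the ten vectors.

    The matrix [Pi h] is affine in [h] ([qform_Pi_convex]), so negativity at
    [h1] and [h2] gives negativity in between. A positive definite form controls
    the norm of each block of its argument ([posdef_norm_bound]); hence, with
    one constant [C] and [V] the functional,
    [|x k|^2 <= C * V] and [|x k|^2 <= C * (V at k - V at k.+1)]. Since [V] is also
    bounded by the square of the largest norm in the history
    ([lyapunov_growth]), the first estimate gives stability; [V] is nonincreasing
    and nonnegative, hence convergent, and the second gives attraction
    ([lyapunov_criterion]). *)

(** * Quadratic forms *)

Section QuadraticForms.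
Set Implicit Arguments.
Unset Strict Implicit.
Unset Printing Implicit Defensive.
Context {R : realType}.

Definition bform m p (M : 'M[R]_(m, p)) (u : 'cV[R]_m) (v : 'cV[R]_p) : R :=
  (u^T *m M *m v) 0 0.

Lemma qform_bform m (M : 'M[R]_m) v : qform M v = bform M v v.
Proof. by []. Qed.

Lemma bformDl m p (M : 'M[R]_(m, p)) u1 u2 v :
  bform M (u1 + u2) v = bform M u1 v + bform M u2 v.
Proof. by rewrite /bform raddfD !mulmxDl mxE. Qed.

Lemma bformDr m p (M : 'M[R]_(m, p)) u v1 v2 :
  bform M u (v1 + v2) = bform M u v1 + bform M u v2.
Proof. by rewrite /bform mulmxDr mxE. Qed.

Lemma bformZl m p (M : 'M[R]_(m, p)) a u v : bform M (a *: u) v = a * bform M u v.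
Proof. by rewrite /bform linearZ -!scalemxAl mxE. Qed.

Lemma bformZr m p (M : 'M[R]_(m, p)) a u v : bform M u (a *: v) = a * bform M u v.
Proof. by rewrite /bform -!scalemxAr mxE. Qed.

Lemma bformNl m p (M : 'M[R]_(m, p)) u v : bform M (- u) v = - bform M u v.
Proof. by rewrite -scaleN1r bformZl mulN1r. Qed.

Lemma bformNr m p (M : 'M[R]_(m, p)) u v : bform M u (- v) = - bform M u v.
Proof. by rewrite -scaleN1r bformZr mulN1r. Qed.

Lemma bform0r m p (M : 'M[R]_(m, p)) u : bform M u 0 = 0.
Proof. by rewrite /bform mulmx0 mxE. Qed.

Lemma bform0l m p (M : 'M[R]_(m, p)) v : bform M 0 v = 0.
Proof. by rewrite /bform trmx0 !mul0mx mxE. Qed.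

Lemma bform_suml m p (M : 'M[R]_(m, p)) I (r : seq I) (F : I -> 'cV[R]_m) v :
  bform M (\sum_(i <- r) F i) v = \sum_(i <- r) bform M (F i) v.
Proof.
elim/big_rec2: _ => [|i y x _ <-]; first by rewrite bform0l.
by rewrite bformDl.
Qed.

Lemma bform_sumr m p (M : 'M[R]_(m, p)) I (r : seq I) (F : I -> 'cV[R]_p) u :
  bform M u (\sum_(i <- r) F i) = \sum_(i <- r) bform M u (F i).
Proof.
elim/big_rec2: _ => [|i y x _ <-]; first by rewrite bform0r.
by rewrite bformDr.
Qed.

Lemma bform_tr m p (M : 'M[R]_(m, p)) u v : bform M u v = bform M^T v u.
Proof.
have -> : bform M u v = ((u^T *m M *m v)^T) 0 0 by rewrite [RHS]mxE.
by rewrite !trmx_mul trmxK mulmxA.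
Qed.

Lemma bform_mxD m p (M N : 'M[R]_(m, p)) u v :
  bform (M + N) u v = bform M u v + bform N u v.
Proof. by rewrite /bform mulmxDr mulmxDl mxE. Qed.

Lemma bform_mxZ m p (M : 'M[R]_(m, p)) a u v : bform (a *: M) u v = a * bform M u v.
Proof. by rewrite /bform -scalemxAr -scalemxAl mxE. Qed.

Lemma bform_mxN m p (M : 'M[R]_(m, p)) u v : bform (- M) u v = - bform M u v.
Proof. by rewrite -scaleN1r bform_mxZ mulN1r. Qed.

Lemma bform_congr m p m' p' (M : 'M[R]_(m', p')) (A : 'M[R]_(m', m))
    (B : 'M[R]_(p', p)) u v :
  bform (A^T *m M *m B) u v = bform M (A *m u) (B *m v).
Proof. by rewrite /bform trmx_mul !mulmxA. Qed.

Lemma bform_block m1 m2 p1 p2 (M1 : 'M[R]_(m1, p1)) (M2 : 'M[R]_(m1, p2))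
    (M3 : 'M[R]_(m2, p1)) (M4 : 'M[R]_(m2, p2)) u1 u2 v1 v2 :
  bform (block_mx M1 M2 M3 M4) (col_mx u1 u2) (col_mx v1 v2)
  = bform M1 u1 v1 + bform M2 u1 v2 + bform M3 u2 v1 + bform M4 u2 v2.
Proof.
rewrite /bform tr_col_mx mul_row_block mul_row_col !mulmxDl !mxE /=.
by ring.
Qed.

Lemma symmx_tr m (M : 'M[R]_m) : M \is symmetricmx -> M^T = M.
Proof.
move/is_hermitianmxP; rewrite expr0 scale1r => {2}->.
by apply/matrixP => i j; rewrite !mxE.
Qed.

Lemma bform_sym m (M : 'M[R]_m) u v : M^T = M -> bform M u v = bform M v u.
Proof. by move=> sM; rewrite bform_tr sM. Qed.

Lemma posdef_psd m (M : 'M[R]_m) : posdefmx M -> possemidefmx M.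
Proof.
case=> sM pM; split=> // v; have [->|/pM/ltW//] := eqVneq v 0.
by rewrite qform_bform bform0r.
Qed.

Lemma negdef_opp m (M : 'M[R]_m) : negdefmx M -> posdefmx (- M).
Proof.
case=> sM nM; split; last by move=> v /nM; rewrite !qform_bform bform_mxN oppr_gt0.
apply/is_hermitianmxP; rewrite expr0 scale1r.
rewrite -{1}(symmx_tr sM).
by apply/matrixP => i j; rewrite !mxE.
Qed.

(** The form is nonnegative at every [a u + b v]. The choices
    [(a, b) = (M(v,v), - M(u,v))] and [(- M(u,v), M(u,u))] settle the case where
    one of the diagonal values is positive; if both vanish, [(1, 1)] and
    [(1, -1)] force [M(u,v) = 0]. *)
Lemma psd_cauchy_schwarz m (M : 'M[R]_m) u v : possemidefmx M ->
  bform M u v ^+ 2 <= qform M u * qform M v.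
Proof.
move=> [sM pM]; have hs := bform_sym _ _ (symmx_tr sM).
have pos a b : 0 <= a ^+ 2 * qform M u + 2 * (a * b) * bform M u v + b ^+ 2 * qform M v.
  suff <- : qform M (a *: u + b *: v) =
    a ^+ 2 * qform M u + 2 * (a * b) * bform M u v + b ^+ 2 * qform M v by exact: pM.
  by rewrite !qform_bform bformDl !bformDr !bformZl !bformZr (hs v u); ring.
have qu := pM u; have qv := pM v.
have h1 := pos (qform M v) (- bform M u v).
have h2 := pos (- bform M u v) (qform M u).
move: h1 h2 qu qv (pos 1 1) (pos 1 (-1)).
move: (qform M u) (qform M v) (bform M u v) => a c b h1 h2 qu qv h3 h4.
have [c0|c0] := ltP 0 c; first by nra.
have c00 : c = 0 by lra.
have [a0|a0] := ltP 0 a; first by nra.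
have a00 : a = 0 by lra.
subst; nra.
Qed.

Lemma posdef_unit m (M : 'M[R]_m) : posdefmx M -> M \in unitmx.
Proof.
case=> _ pM; rewrite -row_free_unit -kermx_eq0; apply/eqP/row_matrixP => i.
rewrite row0; apply/eqP; apply: contraT => ki0.
have := pM (row i (kermx M))^T.
rewrite -(inj_eq (can_inj (@trmxK _ _ _))) trmxK trmx0 => /(_ ki0).
by rewrite /qform trmxK -row_mul mulmx_ker row0 mul0mx mxE ltxx.
Qed.

(** A linear functional [u] is [M (M^-1 u)], so the Cauchy-Schwarz inequality of
    the form [M] itself bounds it; this stands in for a smallest eigenvalue. *)
Lemma posdef_coord_bound m (M : 'M[R]_m) (u : 'cV[R]_m) : posdefmx M ->
  forall v, (u^T *m v) 0 0 ^+ 2 <= qform M (invmx M *m u) * qform M v.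
Proof.
move=> pM v; have := psd_cauchy_schwarz (invmx M *m u) v (posdef_psd pM).
case: (pM) => sM _.
rewrite {1}/bform trmx_mul trmx_inv (symmx_tr sM) -[u^T *m _ *m _]mulmxA.
by rewrite mulVmx ?posdef_unit // mulmx1.
Qed.

Lemma mx_norm_le m p (x : 'M[R]_(m, p)) (a : R) : 0 <= a ->
  (forall i j, `|x i j| <= a) -> `|x| <= a.
Proof.
move=> a0 xa; rewrite /Num.norm /= mx_normrE.
by apply: bigmax_le => // -[i j] _ /=.
Qed.

Lemma mx_entry_le m p (x : 'M[R]_(m, p)) i j : `|x i j| <= `|x|.
Proof.
rewrite [leRHS]/Num.norm /= mx_normrE.
exact: (le_bigmax_cond _ (fun ij => `|x ij.1 ij.2|) (j := (i, j))).
Qed.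

(** With [L] a block row, the form controls the norm of one block of its
    argument. *)
Lemma posdef_norm_bound m p (M : 'M[R]_m) (L : 'M[R]_(p, m)) : posdefmx M ->
  exists2 C, 0 < C & forall v, `|L *m v| ^+ 2 <= C * qform M v.
Proof.
move=> pM; have [_ M0] := posdef_psd pM.
pose c i := qform M (invmx M *m (row i L)^T).
pose C := 1 + \sum_i c i.
have c0 i : 0 <= c i by exact: M0.
have C0 : 0 < C by rewrite ltr_pwDl ?ltr01 // sumr_ge0.
exists C => // v.
have Cv : 0 <= C * qform M v by rewrite mulr_ge0 ?(ltW C0) ?M0.
rewrite -[leRHS]sqr_sqrtr // ler_sqr ?nnegrE ?sqrtr_ge0 //.
apply: mx_norm_le; rewrite ?sqrtr_ge0 // => i j.
rewrite -ler_sqr ?nnegrE ?sqrtr_ge0 // sqr_sqrtr // real_normK ?num_real //.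
have := posdef_coord_bound (row i L)^T pM v.
rewrite trmxK -row_mul !mxE !ord1 => /le_trans; apply.
rewrite ler_wpM2r // -/(c i) /C (bigD1 i) //=.
have : 0 <= \sum_(k < p | k != i) c k by rewrite sumr_ge0.
lra.
Qed.

End QuadraticForms.

(** * Bessel's inequality and summation by parts *)

Section SummationInequalities.
Set Implicit Arguments.
Unset Strict Implicit.
Unset Printing Implicit Defensive.
Context {R : realType}.

(** The [f k] are orthogonal for the weight [w], with squared norms at most
    [1 / c k]. Subtracting from [D] the combination of the [f k] with the
    coefficients [c k * v k], where [v k] pairs [D] with [f k], leaves a
    remainder of nonnegative energy. Asking only for an upper bound on the norms
    allows coefficients below the sharp ones, and a vanishing [f k]. *)
Lemma bessel m (M : 'M[R]_m) K N (w : nat -> R) (f : 'I_K -> nat -> R)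
    (c : 'I_K -> R) (D : nat -> 'cV[R]_m) :
  possemidefmx M ->
  (forall i, 0 <= w i) -> (forall k, 0 <= c k) ->
  (forall k l : 'I_K, (k < l)%N -> \sum_(i < N) w i * (f k i * f l i) = 0) ->
  (forall k, c k * (\sum_(i < N) w i * (f k i * f k i)) <= 1) ->
  \sum_k c k * qform M (\sum_(i < N) (w i * f k i) *: D i)
    <= \sum_(i < N) w i * qform M (D i).
Proof.
move=> [/symmx_tr sM pM] w0 c0 orth norm.
have orth' k l : k != l -> \sum_(i < N) w i * (f k i * f l i) = 0.
  rewrite -val_eqE neq_ltn => /orP[] kl; first exact: orth.
  by apply: etrans (orth _ _ kl); apply: eq_bigr => i _; rewrite (mulrC (f k i)).
pose v k := \sum_(i < N) (w i * f k i) *: D i.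
have : 0 <= \sum_(i < N) w i * qform M (D i - \sum_k (c k * f k i) *: v k).
  by rewrite sumr_ge0 // => i _; rewrite mulr_ge0.
have -> : \sum_(i < N) w i * qform M (D i - \sum_k (c k * f k i) *: v k)
  = \sum_(i < N) (w i * qform M (D i)
      - 2 * (\sum_k c k * bform M ((w i * f k i) *: D i) (v k))
      + \sum_k \sum_l (c k * c l * bform M (v k) (v l)) * (w i * (f k i * f l i))).
  apply: eq_bigr => i _; set s := \sum_k (c k * f k i) *: v k.
  rewrite qform_bform !bformDl !bformDr !bformNl !bformNr (bform_sym s _ sM).
  have e1 : w i * bform M (D i) s = \sum_k c k * bform M ((w i * f k i) *: D i) (v k).
    rewrite /s bform_sumr mulr_sumr; apply: eq_bigr => k _.
    by rewrite bformZr bformZl; ring.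
  have e2 : w i * bform M s s =
     \sum_k \sum_l (c k * c l * bform M (v k) (v l)) * (w i * (f k i * f l i)).
    rewrite {1}/s bform_suml mulr_sumr; apply: eq_bigr => k _.
    rewrite bform_sumr mulr_sumr; apply: eq_bigr => l _.
    by rewrite bformZr bformZl; ring.
  by rewrite -e1 -e2 qform_bform; ring.
rewrite !big_split /= sumrN -mulr_sumr [X in 2 * X]exchange_big /=.
rewrite [X in 2 * X](_ : _ = \sum_k c k * qform M (v k)); last first.
  by apply: eq_bigr => k _; rewrite -mulr_sumr -bform_suml.
rewrite [X in _ + X](_ : _ = \sum_k c k ^+ 2 * qform M (v k)
    * (\sum_(i < N) w i * (f k i * f k i))); last first.
  rewrite exchange_big; apply: eq_bigr => k _ /=.
  rewrite exchange_big (bigD1 k) //= -mulr_sumr.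
  rewrite [X in _ + X]big1 ?addr0 ?expr2 // => l lk.
  by rewrite -mulr_sumr orth' 1?eq_sym // mulr0.
have : \sum_k c k ^+ 2 * qform M (v k) * (\sum_(i < N) w i * (f k i * f k i))
    <= \sum_k c k * qform M (v k).
  apply: ler_sum => k _; have := norm k; have := c0 k; have := pM (v k).
  move: (qform _ _) (c k) (\sum_(i < N) _) => q a b q0 a0 ab.
  have aq0 : 0 <= a * q by rewrite mulr_ge0.
  nra.
rewrite /v.
lra.
Qed.

(** Index [i] counts steps into the past, so [decr y i] is a forward difference
    in time. *)
Definition decr m (y : nat -> 'cV[R]_m) i := y i - y i.+1.

Definition avg1 m (y : nat -> 'cV[R]_m) N : 'cV[R]_m :=
  (T N%:R)^-1 *: \sum_(i < N.+1) y i.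

(** The denominator [gamma N] is the number of terms of the double sum. *)
Definition avg2 m (y : nat -> 'cV[R]_m) N : 'cV[R]_m :=
  (gamma N%:R)^-1 *: \sum_(i < N.+1) \sum_(j < i.+1) y j.

Lemma T_gt0 N : 0 < T N%:R :> R.
Proof. by rewrite /T natr1 ltr0n. Qed.

Lemma gamma_gt0 N : 0 < gamma N%:R :> R.
Proof.
have := ler0n R N; rewrite /gamma /T => N0.
by rewrite divr_gt0 ?mulr_gt0 //; lra.
Qed.

Lemma scalar_sum_decr N (y : nat -> R) :
  \sum_(i < N) (y i - y i.+1) = y 0%N - y N.
Proof.
elim: N => [|N IH]; first by rewrite big_ord0 subrr.
by rewrite big_ord_recr /= IH; ring.
Qed.

Lemma scalar_sum1 N (y : nat -> R) :
  \sum_(i < N) (N%:R - i%:R) * (y i - y i.+1)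
  = N.+1%:R * y 0%N - \sum_(i < N.+1) y i.
Proof.
elim: N => [|N IH]; first by rewrite big_ord0 big_ord1 mul1r subrr.
rewrite big_ord_recr [X in _ = _ - X]big_ord_recr /=.
have -> : \sum_(i < N) (N.+1%:R - i%:R) * (y i - y i.+1) =
  \sum_(i < N) (N%:R - i%:R) * (y i - y i.+1) + (y 0%N - y N).
  rewrite -scalar_sum_decr -big_split /=; apply: eq_bigr => i _.
  by rewrite -natr1; ring.
by rewrite IH -!natr1; ring.
Qed.

Lemma scalar_sum2 N (y : nat -> R) :
  \sum_(i < N) ((N%:R - i%:R) * (N%:R - i%:R + 1) / 2) * (y i - y i.+1)
  = gamma N%:R * y 0%N - \sum_(i < N.+1) \sum_(j < i.+1) y j.
Proof.
elim: N => [|N IH].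
  by rewrite big_ord0 !big_ord1 /gamma /T; field.
rewrite big_ord_recr [X in _ = _ - X]big_ord_recr /=.
have -> : \sum_(i < N) ((N.+1%:R - i%:R) * (N.+1%:R - i%:R + 1) / 2) * (y i - y i.+1) =
  \sum_(i < N) ((N%:R - i%:R) * (N%:R - i%:R + 1) / 2) * (y i - y i.+1)
  + \sum_(i < N) (N%:R - i%:R) * (y i - y i.+1) + (y 0%N - y N).
  rewrite -scalar_sum_decr -!big_split /=; apply: eq_bigr => i _.
  by rewrite -natr1; field.
rewrite IH scalar_sum1 [X in _ = _ - (_ + X)]big_ord_recr /= /gamma /T -!natr1.
by field.
Qed.

(** Summation by parts: with [r = N - i], the weights 1, [r] and [r (r + 1) / 2]
    turn the increments into the endpoints and the two averages. Each row of
    the Gamma matrices is thus a polynomially weighted sum of increments. *)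
Lemma decr_sum m (y : nat -> 'cV[R]_m) N (a b c : R) :
  \sum_(i < N) (a + b * (N%:R - i%:R)
      + c * ((N%:R - i%:R) * (N%:R - i%:R + 1) / 2)) *: decr y i
  = (a + b * T N%:R + c * gamma N%:R) *: y 0%N - a *: y N
    - (b * T N%:R) *: avg1 y N - (c * gamma N%:R) *: avg2 y N.
Proof.
rewrite !scalerA !mulfK ?gt_eqF ?T_gt0 ?gamma_gt0 //.
apply/colP => j; rewrite summxE !mxE !summxE.
under [X in _ = _ - c * X]eq_bigr => i _ do rewrite summxE.
pose z i := y i j 0.
transitivity (a * (\sum_(i < N) (z i - z i.+1))
  + b * (\sum_(i < N) (N%:R - i%:R) * (z i - z i.+1))
  + c * (\sum_(i < N) ((N%:R - i%:R) * (N%:R - i%:R + 1) / 2) * (z i - z i.+1))).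
  rewrite !mulr_sumr -!big_split /=; apply: eq_bigr => i _.
  by rewrite !mxE /z; ring.
rewrite scalar_sum_decr scalar_sum1 scalar_sum2 /z /T -natr1; ring.
Qed.

(** Polynomials in [N - i] rather than [i]: these are unchanged when [N] and [i]
    both increase, which is what an induction removing the first term needs. *)
Lemma moment_sum N (a0 a1 a2 a3 a4 : R) :
  let r i := N%:R - i%:R in let n := N%:R in
  \sum_(i < N) (a0 + a1 * r i + a2 * r i ^+ 2 + a3 * r i ^+ 3 + a4 * r i ^+ 4)
  = a0 * n + a1 * (n * (n + 1) / 2) + a2 * (n * (n + 1) * (2 * n + 1) / 6)
    + a3 * (n ^+ 2 * (n + 1) ^+ 2 / 4)
    + a4 * (n * (n + 1) * (2 * n + 1) * (3 * n ^+ 2 + 3 * n - 1) / 30).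
Proof.
elim: N => [|N IH] r n; first by rewrite big_ord0 /n; field.
rewrite big_ord_recl /=.
rewrite (eq_bigr (fun i : 'I_N => let s := N%:R - i%:R in
   a0 + a1 * s + a2 * s ^+ 2 + a3 * s ^+ 3 + a4 * s ^+ 4)); last first.
  by move=> i _; rewrite /r /= /bump /= add1n -!natr1; ring.
by rewrite IH /r /n subr0 -natr1; field.
Qed.

End SummationInequalities.

(** * Summation inequalities for increments *)

Section WirtingerType.
Set Implicit Arguments.
Unset Strict Implicit.
Unset Printing Implicit Defensive.
Context {R : realType}.

(** Bessel's inequality for the discrete Legendre polynomials of degrees 0, 1, 2
    on [N] points. Their squared norms are [N], [N (N-1) / (3 (N+1))] and
    [N (N-1) (N-2) / (5 (N+1) (N+2))], and the conditions on the [c]s say that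
    each is at most the inverse norm; in product form they also cover the small
    [N] for which a polynomial vanishes. *)
Lemma summation_ineq3 m (M : 'M[R]_m) (y : nat -> 'cV[R]_m) N (c0 c1 c2 : R) :
  possemidefmx M -> 0 <= c0 -> 0 <= c1 -> 0 <= c2 ->
  c0 * N%:R <= 1 -> c1 * (N%:R * (N%:R - 1)) <= 3 * (N%:R + 1) ->
  c2 * (N%:R * (N%:R - 1) * (N%:R - 2)) <= 5 * ((N%:R + 1) * (N%:R + 2)) ->
  c0 * qform M (y 0%N - y N)
  + c1 * qform M (y 0%N + y N - 2 *: avg1 y N)
  + c2 * qform M (y 0%N - y N + 6 *: avg1 y N - 6 *: avg2 y N)
  <= \sum_(i < N) qform M (decr y i).
Proof.
move=> pM c00 c10 c20 c0n c1n c2n.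
pose n : R := N%:R; have n0 : 0 <= n by exact: ler0n.
have nT : T n = n + 1 by [].
have nG : gamma n = (n + 1) * (n + 2) / 2 by rewrite /gamma /T; field.
have n1' : n + 1 != 0 by apply/eqP; lra.
have n2' : n + 2 != 0 by apply/eqP; lra.
(* f k is the k-th polynomial in the basis 1, r, r (r + 1) / 2 with r = N - i. *)
pose b (k : 'I_3) : R := [:: 0; 2 / (n + 1); - 6 / (n + 1)]`_k.
pose a (k : 'I_3) : R := [:: 1; - 1; 1]`_k.
pose g (k : 'I_3) : R := [:: 0; 0; 12 / ((n + 1) * (n + 2))]`_k.
pose f k i := a k + b k * (n - i%:R) + g k * ((n - i%:R) * (n - i%:R + 1) / 2).
pose c (k : 'I_3) : R := [:: c0; c1; c2]`_k.
have gram k l : \sum_(i < N) 1 * (f k i * f l i) =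
  a k * a l * n + (a k * (b l + g l / 2) + a l * (b k + g k / 2)) * (n * (n + 1) / 2)
  + (a k * g l / 2 + a l * g k / 2 + (b k + g k / 2) * (b l + g l / 2))
     * (n * (n + 1) * (2 * n + 1) / 6)
  + ((b k + g k / 2) * g l / 2 + (b l + g l / 2) * g k / 2) * (n ^+ 2 * (n + 1) ^+ 2 / 4)
  + g k * g l / 4 * (n * (n + 1) * (2 * n + 1) * (3 * n ^+ 2 + 3 * n - 1) / 30).
  by rewrite -moment_sum; apply: eq_bigr => i _; rewrite /f -/n; field.
have vec k : \sum_(i < N) (1 * f k i) *: decr y i =
    (a k + b k * T n + g k * gamma n) *: y 0%N - a k *: y N
    - (b k * T n) *: avg1 y N - (g k * gamma n) *: avg2 y N.
  by rewrite -decr_sum; apply: eq_bigr => i _; rewrite mul1r.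
move: (avg1 y N) (avg2 y N) vec => y1 y2 vec.
have := @bessel R m M 3 N (fun=> 1) f c (decr y) pM.
have -> : \sum_(i < N) (1 : R) * qform M (decr y i) = \sum_(i < N) qform M (decr y i).
  by apply: eq_bigr => i _; rewrite mul1r.
rewrite !big_ord_recl big_ord0 addr0 !vec /c /= nT nG.
have -> : (a ord0 + b ord0 * (n + 1) + g ord0 * ((n + 1) * (n + 2) / 2)) *: y 0%N
  - a ord0 *: y N - (b ord0 * (n + 1)) *: y1
  - (g ord0 * ((n + 1) * (n + 2) / 2)) *: y2 = y 0%N - y N.
  by apply/colP => j; rewrite /a /b /g /= !mxE; field.
set k1 := lift _ _.
have -> : (a k1 + b k1 * (n + 1) + g k1 * ((n + 1) * (n + 2) / 2)) *: y 0%N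
  - a k1 *: y N - (b k1 * (n + 1)) *: y1
  - (g k1 * ((n + 1) * (n + 2) / 2)) *: y2 = y 0%N + y N - 2 *: y1.
  by apply/colP => j; rewrite /a /b /g /= !mxE; field; rewrite n1'.
set k2 := lift _ _.
have -> : (a k2 + b k2 * (n + 1) + g k2 * ((n + 1) * (n + 2) / 2)) *: y 0%N
  - a k2 *: y N - (b k2 * (n + 1)) *: y1
  - (g k2 * ((n + 1) * (n + 2) / 2)) *: y2
  = y 0%N - y N + 6 *: y1 - 6 *: y2.
  by apply/colP => j; rewrite /a /b /g /= !mxE; field; rewrite n1' n2'.
rewrite addrA; apply => //.
- by move=> [[|[|[|//]]] ?].
- move=> k l kl; rewrite gram.
  move: k l kl => [[|[|[|//]]] ?] [[|[|[|//]]] ?] //= _; rewrite /a /b /g /=; field;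
    by rewrite ?n1' ?n2'.
- move=> k; rewrite gram.
  move: k => [[|[|[|//]]] ?]; rewrite /a /b /g /=.
  + by rewrite (_ : _ * _ = c0 * n); [|field].
  + rewrite (_ : _ * _ = c1 * (n * (n - 1)) / (3 * (n + 1))); last by field.
    by rewrite ler_pdivrMr ?mul1r //; lra.
  + rewrite (_ : _ * _ = c2 * (n * (n - 1) * (n - 2)) / (5 * ((n + 1) * (n + 2)))); last first.
      by field; rewrite n1' n2'.
    by rewrite ler_pdivrMr ?mul1r // !mulr_gt0 //; lra.
Qed.

(** Bessel's inequality for the weight [i + 1] and orthogonal polynomials of
    degrees 0 and 1, of squared norms [N / (2 (N+1))] and
    [N (N-1) / (4 (N+1) (N+2))]. *)
Lemma weighted_summation_ineq2 m (M : 'M[R]_m) (y : nat -> 'cV[R]_m) N (c1 c2 : R) :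
  possemidefmx M -> 0 <= c1 -> 0 <= c2 ->
  c1 * N%:R <= 2 * (N%:R + 1) ->
  c2 * (N%:R * (N%:R - 1)) <= 4 * ((N%:R + 1) * (N%:R + 2)) ->
  c1 * qform M (y N - avg1 y N)
  + c2 * qform M (y N - 4 *: avg1 y N + 3 *: avg2 y N)
  <= \sum_(i < N) i.+1%:R * qform M (decr y i).
Proof.
move=> pM c10 c20 c1n c2n.
pose n : R := N%:R; have n0 : 0 <= n by exact: ler0n.
have nT : T n = n + 1 by [].
have nG : gamma n = (n + 1) * (n + 2) / 2 by rewrite /gamma /T; field.
have n1' : n + 1 != 0 by apply/eqP; lra.
have n2' : n + 2 != 0 by apply/eqP; lra.
(* Times the weight i + 1, these polynomials of degree 0 and 1 become the
   combinations of 1, r, r (r + 1) / 2 that produce y N - avg1 and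
   y N - 4 avg1 + 3 avg2. *)
pose a (k : 'I_2) : R := [:: - (n + 1)^-1; - (n + 1)^-1]`_k.
pose b (k : 'I_2) : R := [:: 0; 3 / ((n + 1) * (n + 2))]`_k.
pose f k i := a k + b k * (n - i%:R).
pose c (k : 'I_2) : R := [:: c1; c2]`_k.
have gram k l : \sum_(i < N) i.+1%:R * (f k i * f l i) =
  (n + 1) * (a k * a l) * n
  + ((n + 1) * (a k * b l + b k * a l) - a k * a l) * (n * (n + 1) / 2)
  + ((n + 1) * (b k * b l) - (a k * b l + b k * a l)) * (n * (n + 1) * (2 * n + 1) / 6)
  + (- (b k * b l)) * (n ^+ 2 * (n + 1) ^+ 2 / 4)
  + 0 * (n * (n + 1) * (2 * n + 1) * (3 * n ^+ 2 + 3 * n - 1) / 30).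
  by rewrite -moment_sum; apply: eq_bigr => i _; rewrite /f -/n -natr1; ring.
have vec k : \sum_(i < N) (i.+1%:R * f k i) *: decr y i =
    ((n + 1) * a k + ((n + 1) * b k - a k + b k) * T n + (- 2 * b k) * gamma n) *: y 0%N
    - ((n + 1) * a k) *: y N
    - (((n + 1) * b k - a k + b k) * T n) *: avg1 y N - ((- 2 * b k) * gamma n) *: avg2 y N.
  rewrite -decr_sum; apply: eq_bigr => i _; congr (_ *: _).
  by rewrite /f -/n -natr1; field.
move: (avg1 y N) (avg2 y N) vec => y1 y2 vec.
have := @bessel R m M 2 N (fun i => i.+1%:R) f c (decr y) pM.
rewrite !big_ord_recl big_ord0 addr0 !vec /c /= nT nG.
set v0 := (X in qform M X); have -> : v0 = y N - y1.
  by apply/colP => j; rewrite /v0 /a /b /= !mxE; field; rewrite n1'.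
set v2 := (X in _ + _ * qform M X <= \sum_(_ < _) _ * _).
have -> : v2 = y N - 4 *: y1 + 3 *: y2.
  by apply/colP => j; rewrite /v2 /a /b /= !mxE; field; rewrite n1' n2'.
apply => //.
- by move=> [[|[|//]] ?].
- move=> k l kl; rewrite gram.
  move: k l kl => [[|[|//]] ?] [[|[|//]] ?] //= _; rewrite /a /b /=; field;
    by rewrite ?n1' ?n2'.
- move=> k; rewrite gram.
  move: k => [[|[|//]] ?]; rewrite /a /b /=.
  + rewrite (_ : _ * _ = c1 * n / (2 * (n + 1))); last by field.
    by rewrite ler_pdivrMr ?mul1r //; lra.
  + rewrite (_ : _ * _ = c2 * (n * (n - 1)) / (4 * ((n + 1) * (n + 2)))); last first.
      by field; rewrite n1' n2'.
    by rewrite ler_pdivrMr ?mul1r // !mulr_gt0 //; lra.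
Qed.

(** For positive lengths the claim exceeds the hypotheses by
    [(N2/N1) M(u,u) + (N1/N2) M(v,v) - 2 X(u,v)], which up to a factor [N1 N2] is
    the block form at [(N2 u, - N1 v)]. If a length is zero, its vector is zero and
    there is no cross term. *)
Lemma reciprocally_convex m (M : 'M[R]_m) (X : 'M[R]_m) (N1 N2 : nat) u v s1 s2 :
  possemidefmx (block_mx M X X^T M) ->
  (N1 = 0%N -> u = 0) -> (N2 = 0%N -> v = 0) -> 0 <= s1 -> 0 <= s2 ->
  qform M u <= N1%:R * s1 -> qform M v <= N2%:R * s2 ->
  qform (block_mx M X X^T M) (col_mx u v) <= (N1 + N2)%:R * (s1 + s2).
Proof.
move=> [_ pB] u0 v0 s10 s20 us vs.
have E w z : qform (block_mx M X X^T M) (col_mx w z) =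
    qform M w + 2 * bform X w z + qform M z.
  by rewrite !qform_bform bform_block -(bform_tr X); ring.
case: N1 N2 u0 v0 us vs => [|N1] [|N2].
- move=> -> // -> // _ _.
  by rewrite E !qform_bform !bform0l mulr0 !addr0 mulr_ge0 ?ler0n ?addr_ge0.
- move=> -> // _ _ vs; rewrite E !qform_bform !bform0l mulr0 !add0r add0n.
  by apply: le_trans vs _; rewrite ler_wpM2l ?ler0n ?lerDr.
- move=> _ -> // us _; rewrite E !qform_bform !bform0r mulr0 !addr0 addn0.
  by apply: le_trans us _; rewrite ler_wpM2l ?ler0n ?lerDl.
move=> _ _; rewrite E natrD.
have := pB (col_mx (N2.+1%:R *: u) (- N1.+1%:R *: v)).
rewrite E !qform_bform !bformZl !bformZr.
have : 0 < N1.+1%:R :> R by rewrite ltr0n.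
have : 0 < N2.+1%:R :> R by rewrite ltr0n.
move: N1.+1%:R N2.+1%:R (bform M u u) (bform M v v) (bform X u v) => a b p q r b0 a0 H up vq.
have ab : 0 < a * b by rewrite mulr_gt0.
rewrite -(ler_pM2l ab); nra.
Qed.

End WirtingerType.

(** * Evaluating the matrix inequality on block vectors *)

Section BlockRows.
Set Implicit Arguments.
Unset Strict Implicit.
Unset Printing Implicit Defensive.
Context {R : realType} (n : nat).

Lemma castmx_mul_tr p q (en : p = n) (B C : 'M[R]_(p, q)) :
  castmx (en, erefl q) B *m (castmx (en, erefl q) C)^T = castmx (en, en) (B *m C^T).
Proof. by case: n / en. Qed.

(** The ten block rows are orthonormal, so a vector with prescribed blocks is
    obtained by summing the transposed rows against them. *)
Lemma e_mul_tr i j : (0 < i <= 10)%N -> (0 < j <= 10)%N ->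
  e R n i *m (e R n j)^T = (i == j)%:R *: 1%:M.
Proof.
move=> /andP[i0 i10] /andP[j0 j10]; rewrite /e castmx_mul_tr mxtens.trmx_tens trmx1.
rewrite mxtens.tensmx_mul mulmx1 trmx_delta mul_delta_mx_cond.
have -> : (inord i.-1 == inord j.-1 :> 'I_10) = (i == j).
  case: i j i0 i10 j0 j10 => [//|i] [//|j] _ i10 _ j10.
  by rewrite -val_eqE /= !inordK // eqSS.
have -> : delta_mx 0 0 = 1%:M :> 'M[R]_1.
  by apply/matrixP => a b; rewrite !mxE !ord1 eqxx.
rewrite -scaler_nat !scale_scalar_mx !mulr1 mxtens.tens_scalar_mx castmx_comp scale_scalar_mx mulr1.
by apply/matrixP => a b; rewrite castmxE !cast_ord_id.
Qed.

Definition stack (z : nat -> 'cV[R]_n) : 'cV[R]_(10 * n) :=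
  \sum_(1 <= i < 11) (e R n i)^T *m z i.

Lemma e_stack z i : (0 < i <= 10)%N -> e R n i *m stack z = z i.
Proof.
move=> i10; rewrite /stack mulmx_sumr big_nat.
under eq_bigr => j j10 do rewrite mulmxA e_mul_tr // -scalemxAl mul1mx.
rewrite -big_nat (bigD1_seq i) ?iota_uniq ?mem_index_iota //=.
rewrite eqxx scale1r big1 ?addr0 // => j; rewrite eq_sym => /negPf->.
by rewrite scale0r.
Qed.

End BlockRows.

Section EvaluateLMI.
Set Implicit Arguments.
Unset Strict Implicit.
Unset Printing Implicit Defensive.
Context {R : realType} (n : nat).

Lemma mul_col3 p q (a b c : 'M[R]_(n, p)) (v : 'M[R]_(p, q)) :
  col3 a b c *m v = col3 (a *m v) (b *m v) (c *m v).
Proof. by rewrite /col3 !mul_col_mx. Qed.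

Lemma mul_col4 p q (a b c d : 'M[R]_(n, p)) (v : 'M[R]_(p, q)) :
  col4 a b c d *m v = col4 (a *m v) (b *m v) (c *m v) (d *m v).
Proof. by rewrite /col4 !mul_col_mx. Qed.

Lemma qform_diag2 (M1 M2 : 'M[R]_n) a b :
  qform (diag2 M1 M2) (col_mx a b) = qform M1 a + qform M2 b.
Proof.
by rewrite !qform_bform bform_block /bform !mulmx0 !mul0mx !mxE !addr0.
Qed.

Lemma qform_diag3 (M1 M2 M3 : 'M[R]_n) a b c :
  qform (diag3 M1 M2 M3) (col3 a b c) = qform M1 a + qform M2 b + qform M3 c.
Proof.
rewrite !qform_bform !bform_block /bform !mulmx0 !mul0mx !mxE !addr0.
by rewrite addrA.
Qed.

Lemma qform_mxD m (M N : 'M[R]_m) v : qform (M + N) v = qform M v + qform N v.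
Proof. exact: bform_mxD. Qed.

Lemma qform_mxN m (M : 'M[R]_m) v : qform (- M) v = - qform M v.
Proof. exact: bform_mxN. Qed.

Lemma qform_mxZ m (M : 'M[R]_m) a v : qform (a *: M) v = a * qform M v.
Proof. exact: bform_mxZ. Qed.

Lemma qform_congr m p (M : 'M[R]_p) (B : 'M[R]_(p, m)) v :
  qform (B^T *m M *m B) v = qform M (B *m v).
Proof. exact: bform_congr. Qed.

Lemma qform_He m (M : 'M[R]_m) v : qform (He M) v = 2 * qform M v.
Proof. by rewrite qform_mxD !qform_bform -bform_tr; ring. Qed.

(** The matrix is
    [(O - O1)^T M (O - O1) - (O - O2)^T M (O - O2)]: the terms quadratic in [O]
    cancel. *)
Lemma qform_difference m p (M : 'M[R]_p) (O O1 O2 : 'M[R]_(p, m)) v : M^T = M ->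
  qform (He (O^T *m M *m (O2 - O1)) + O1^T *m M *m O1 - O2^T *m M *m O2) v
  = qform M (O *m v - O1 *m v) - qform M (O *m v - O2 *m v).
Proof.
move=> sM; rewrite qform_mxD qform_mxN qform_mxD qform_He !qform_congr qform_bform bform_congr.
rewrite mulmxBl; move: (O *m v) (O1 *m v) (O2 *m v) => o o1 o2.
rewrite !qform_bform !bformDr !bformDl !bformNl !bformNr.
by rewrite (bform_sym o1 o sM) (bform_sym o2 o sM); ring.
Qed.

(** The values of the summands of [Pi] depend on the block rows only through the
    vectors [E i *m v], so any family of matrices may play the role of the rows
    [e R n i], and any [c] that of [calA]. *)
Section AbstractRows.
Context (q : nat) (E : nat -> 'M[R]_(n, q)) (c : 'M[R]_(n, q)) (v : 'cV[R]_q).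
Context (a b : R).

Let z i := E i *m v.

Lemma qform_Pi0 (P : 'M[R]_(n + (n + (n + n)))) t0 t1 t2 g0 : P^T = P ->
  let O := col4 (E 1%N) (t0 *: E 5%N) (t1 *: E 6%N + t2 *: E 7%N) (g0 *: E 8%N) in
  let O1 := col4 (- c) (E 2%N) (E 3%N + E 4%N) (t0 *: E 5%N) in
  let O2 := col4 0 (E 1%N) (E 2%N + E 3%N) (t0 *: E 1%N) in
  qform (He (O^T *m P *m (O2 - O1)) + O1^T *m P *m O1 - O2^T *m P *m O2) v
  = qform P (col4 (z 1%N + c *m v) (t0 *: z 5%N - z 2%N)
      (t1 *: z 6%N + t2 *: z 7%N - z 3%N - z 4%N) (g0 *: z 8%N - t0 *: z 5%N))
    - qform P (col4 (z 1%N) (t0 *: z 5%N - z 1%N)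
      (t1 *: z 6%N + t2 *: z 7%N - z 2%N - z 3%N) (g0 *: z 8%N - t0 *: z 1%N)).
Proof.
move=> sP O O1 O2; rewrite qform_difference // !mul_col4 /col4 !opp_col_mx !add_col_mx.
rewrite !mulmxDl !mulNmx !opprK mul0mx subr0 -!scalemxAl !opprD !addrA.
by [].
Qed.

Lemma qform_Pi1 (Q1 Q2 : 'M[R]_n) :
  qform ((E 1%N)^T *m Q1 *m E 1%N - (E 2%N)^T *m Q1 *m E 2%N
    + (E 2%N)^T *m Q2 *m E 2%N - (E 4%N)^T *m Q2 *m E 4%N) v
  = qform Q1 (z 1%N) - qform Q1 (z 2%N) + qform Q2 (z 2%N) - qform Q2 (z 4%N).
Proof. by rewrite !(qform_mxD, qform_mxN) !qform_congr. Qed.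

Lemma qform_Pi2 (M1 M2 M3 M4 : 'M[R]_n) a1 a2 a3 a4 :
  qform (c^T *m (a1 *: M1 + a2 *: M2 + a3 *: M3 + a4 *: M4) *m c) v
  = a1 * qform M1 (c *m v) + a2 * qform M2 (c *m v)
    + a3 * qform M3 (c *m v) + a4 * qform M4 (c *m v).
Proof. by rewrite qform_congr !qform_mxD !qform_mxZ. Qed.

Lemma mul_Legendre3 i j k l :
  col3 (E i - E j) (E i + E j - 2 *: E k) (E i - E j + 6 *: E k - 6 *: E l) *m v
  = col3 (z i - z j) (z i + z j - 2 *: z k) (z i - z j + 6 *: z k - 6 *: z l).
Proof. by rewrite mul_col3 !mulmxDl !mulNmx -!scalemxAl. Qed.

Lemma qform_Pi3 (M : 'M[R]_n) (i j k l : nat) :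
  let G := col3 (E i - E j) (E i + E j - 2 *: E k) (E i - E j + 6 *: E k - 6 *: E l) in
  qform (G^T *m diag3 M (a *: M) (b *: M) *m G) v
  = qform M (z i - z j) + a * qform M (z i + z j - 2 *: z k)
    + b * qform M (z i - z j + 6 *: z k - 6 *: z l).
Proof. by move=> G; rewrite qform_congr mul_Legendre3 qform_diag3 !qform_mxZ. Qed.

Lemma qform_Pi4 (M : 'M[R]_((n + (n + n)) + (n + (n + n)))) (i j k l i' j' k' l' : nat) :
  let G := col_mx
    (col3 (E i - E j) (E i + E j - 2 *: E k) (E i - E j + 6 *: E k - 6 *: E l))
    (col3 (E i' - E j') (E i' + E j' - 2 *: E k') (E i' - E j' + 6 *: E k' - 6 *: E l')) in
  qform (G^T *m M *m G) v = qform M (col_mx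
    (col3 (z i - z j) (z i + z j - 2 *: z k) (z i - z j + 6 *: z k - 6 *: z l))
    (col3 (z i' - z j') (z i' + z j' - 2 *: z k') (z i' - z j' + 6 *: z k' - 6 *: z l'))).
Proof. by move=> G; rewrite qform_congr mul_col_mx !mul_Legendre3. Qed.

Lemma qform_Pi5 (M : 'M[R]_n) (i j k : nat) :
  let G := col_mx (E i - E j) (E i - 4 *: E j + 3 *: E k) in
  qform (a *: (G^T *m diag2 M (b *: M) *m G)) v
  = a * (qform M (z i - z j) + b * qform M (z i - 4 *: z j + 3 *: z k)).
Proof.
move=> G; rewrite qform_mxZ qform_congr mul_col_mx qform_diag2 qform_mxZ.
by rewrite !mulmxDl !mulNmx -!scalemxAl.
Qed.

Lemma qform_Pi6 (M : 'M[R]_n) (i j k i' j' k' : nat) :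
  let G := col_mx (E i - E j) (E i' - E j') in
  let G' := col_mx (E i - 4 *: E j + 3 *: E k) (E i' - 4 *: E j' + 3 *: E k') in
  qform (a *: (G^T *m diag2 M M *m G) + b *: (G'^T *m diag2 M M *m G')) v
  = a * (qform M (z i - z j) + qform M (z i' - z j'))
    + b * (qform M (z i - 4 *: z j + 3 *: z k) + qform M (z i' - 4 *: z j' + 3 *: z k')).
Proof.
move=> G G'; rewrite qform_mxD !qform_mxZ !qform_congr !mul_col_mx !qform_diag2.
by rewrite !mulmxDl !mulNmx -!scalemxAl.
Qed.

End AbstractRows.

Context (A Ad : 'M[R]_n) (h1 h2 : R).
Context (P : 'M[R]_(n + (n + (n + n)))) (Q1 Q2 R1 R2 S1 S2 : 'M[R]_n).
Context (X : 'M[R]_(n + (n + n))).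

Local Notation Pi_ := (Pi A Ad h1 h2 P Q1 Q2 R1 R2 S1 S2 X).

(** The delay enters [Pi] through [Omega] alone, and [Omega] is affine in it. *)
Lemma Omega_convex t a b :
  Omega n h1 h2 ((1 - t) * a + t * b) = (1 - t) *: Omega n h1 h2 a + t *: Omega n h1 h2 b.
Proof.
rewrite /Omega /col4 !scale_col_mx !add_col_mx; congr col_mx; last congr col_mx;
  last congr col_mx.
- by rewrite -scalerDl subrK scale1r.
- by rewrite -scalerDl subrK scale1r.
- by apply/matrixP => i j; rewrite !mxE /T; ring.
- by rewrite -scalerDl subrK scale1r.
Qed.

Lemma qform_Pi_convex t a b v :
  qform (Pi_ ((1 - t) * a + t * b)) v = (1 - t) * qform (Pi_ a) v + t * qform (Pi_ b) v.
Proof.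
have [W [C PiE]] : exists W C, forall h,
    Pi_ h = He ((Omega n h1 h2 h)^T *m P *m W) + C.
  by do 2!eexists; move=> h; rewrite /Pi /Pi0 -!addrA; reflexivity.
have qPi h : qform (Pi_ h) v = 2 * bform P (Omega n h1 h2 h *m v) (W *m v) + qform C v.
  by rewrite PiE qform_mxD qform_He qform_bform bform_congr.
apply: etrans (qPi _) _.
apply: etrans _ (esym (congr2 (fun x y => (1 - t) * x + t * y) (qPi a) (qPi b))).
rewrite {qPi PiE} Omega_convex.
move: (Omega n h1 h2 a) (Omega n h1 h2 b) => Oa Ob.
rewrite mulmxDl -!scalemxAl bformDl !bformZl.
by ring.
Qed.

Lemma qform_Pi h v : P^T = P ->
  let z i := e R n i *m v in
  let dx := calA A Ad *m v in
  qform (Pi_ h) v =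
    qform P (col4 (z 1%N + dx) (T h1 *: z 5%N - z 2%N)
      (T (h - h1) *: z 6%N + T (h2 - h) *: z 7%N - z 3%N - z 4%N)
      (gamma h1 *: z 8%N - T h1 *: z 5%N))
  - qform P (col4 (z 1%N) (T h1 *: z 5%N - z 1%N)
      (T (h - h1) *: z 6%N + T (h2 - h) *: z 7%N - z 2%N - z 3%N)
      (gamma h1 *: z 8%N - T h1 *: z 1%N))
  + (qform Q1 (z 1%N) - qform Q1 (z 2%N) + qform Q2 (z 2%N) - qform Q2 (z 4%N))
  + (h1 ^+ 2 * qform R1 dx + (h2 - h1) ^+ 2 * qform R2 dx
     + gamma (h1 - 1) * qform S1 dx + gamma (h2 - h1 - 1) * qform S2 dx)
  - (qform R1 (z 1%N - z 2%N)
     + 3 * c1 h1 * qform R1 (z 1%N + z 2%N - 2 *: z 5%N)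
     + 5 * c2 h1 * qform R1 (z 1%N - z 2%N + 6 *: z 5%N - 6 *: z 8%N))
  - qform (Rtilde2X R2 X) (col_mx
      (col3 (z 2%N - z 3%N) (z 2%N + z 3%N - 2 *: z 6%N)
         (z 2%N - z 3%N + 6 *: z 6%N - 6 *: z 9%N))
      (col3 (z 3%N - z 4%N) (z 3%N + z 4%N - 2 *: z 7%N)
         (z 3%N - z 4%N + 6 *: z 7%N - 6 *: z 10%N)))
  - 2 * (h1 + 1) / h1 * (qform S1 (z 2%N - z 5%N)
      + 2 * c3 h1 * qform S1 (z 2%N - 4 *: z 5%N + 3 *: z 8%N))
  - (2 * (qform S2 (z 3%N - z 6%N) + qform S2 (z 4%N - z 7%N))
     + 4 * (qform S2 (z 3%N - 4 *: z 6%N + 3 *: z 9%N)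
            + qform S2 (z 4%N - 4 *: z 7%N + 3 *: z 10%N))).
Proof.
move=> sP z dx.
rewrite /Pi.
have split7 (M0 M1 M2 M3 M4 M5 M6 : 'M[R]_(10 * n)) :
    qform (M0 + M1 + M2 - M3 - M4 - M5 - M6) v = qform M0 v + qform M1 v
      + qform M2 v - qform M3 v - qform M4 v - qform M5 v - qform M6 v.
  by rewrite !(qform_mxD, qform_mxN).
rewrite split7 {split7}.
congr (_ + _ + _ - _ - _ - _ - _).
- exact: (qform_Pi0 (e R n) (calA A Ad)).
- exact: qform_Pi1.
- exact: qform_Pi2.
- exact: qform_Pi3.
- exact: qform_Pi4.
- exact: qform_Pi5.
- exact: qform_Pi6.
Qed.

End EvaluateLMI.

(** * The summation inequalities with the constants of the criterion *)

Section SegmentBounds.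
Set Implicit Arguments.
Unset Strict Implicit.
Unset Printing Implicit Defensive.
Context {R : realType} (n : nat).

(** For [N] at least 3 the sharp third coefficient would be
    [5 (N+1) (N+2) / ((N-1) (N-2))]; [5 * c2 N] is smaller because
    [N^2 - 4 <= N^2 + 11]. *)
Lemma Pi3_bound (M : 'M[R]_n) (y : nat -> 'cV[R]_n) N :
  possemidefmx M -> (0 < N)%N ->
  qform M (y 0%N - y N) + 3 * c1 N%:R * qform M (y 0%N + y N - 2 *: avg1 y N)
  + 5 * c2 N%:R * qform M (y 0%N - y N + 6 *: avg1 y N - 6 *: avg2 y N)
  <= N%:R * \sum_(i < N) qform M (decr y i).
Proof.
move=> pM N0; have n1 : 1 <= N%:R :> R by rewrite ler1n.
have n0 : 0 < N%:R :> R by rewrite ltr0n.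
set n' : R := N%:R in n1 n0 *.
have [c1_ge0 c1_le] : 0 <= c1 n' /\ c1 n' * (n' - 1) <= n' + 1.
  rewrite /c1; case: eqVneq => [->|n'1]; first by split; lra.
  have n'gt : 0 < n' - 1 by rewrite subr_gt0 lt_neqAle eq_sym n'1.
  split; first by rewrite divr_ge0; lra.
  by rewrite divfK ?gt_eqF.
have [c2_ge0 c2_le] :
    0 <= c2 n' /\ c2 n' * ((n' - 1) * (n' - 2)) <= (n' + 1) * (n' + 2).
  rewrite /c2; case: eqVneq => [->|n'1]; first by split; lra.
  have n'gt : 0 < n' - 1 by rewrite subr_gt0 lt_neqAle eq_sym n'1.
  have den : 0 < n' ^+ 2 + 11 by nra.
  split.
    by rewrite divr_ge0 // mulr_ge0 ?sqr_ge0 ?ltW //; lra.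
  rewrite (_ : _ * _ = (n' + 1) * (n' + 2) * ((n' ^+ 2 - 4) / (n' ^+ 2 + 11))); last first.
    by field; rewrite !gt_eqF.
  rewrite -[leRHS]mulr1 ler_wpM2l ?ler_pdivrMr //; last by lra.
  by rewrite mulr_ge0 //; lra.
have := @summation_ineq3 _ _ M y N n'^-1 (3 * c1 n' / n') (5 * c2 n' / n') pM.
rewrite -/n' => H; apply: le_trans _ (ler_wpM2l (ltW n0) (H _ _ _ _ _ _)).
- by rewrite le_eqVlt; apply/orP; left; apply/eqP; field; rewrite gt_eqF.
- by rewrite invr_ge0 ltW.
- by rewrite divr_ge0 ?mulr_ge0 // (ltW n0).
- by rewrite divr_ge0 ?mulr_ge0 // (ltW n0).
- by rewrite mulVf ?gt_eqF.
- rewrite (_ : _ * _ = 3 * (c1 n' * (n' - 1))); last by field; rewrite gt_eqF.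
  by rewrite ler_pM2l.
- rewrite (_ : _ * _ = 5 * (c2 n' * ((n' - 1) * (n' - 2)))); last by field; rewrite gt_eqF.
  by rewrite ler_pM2l.
Qed.

Lemma Pi5_bound (M : 'M[R]_n) (y : nat -> 'cV[R]_n) N :
  possemidefmx M -> (0 < N)%N ->
  2 * (N%:R + 1) / N%:R * (qform M (y N - avg1 y N)
    + 2 * c3 N%:R * qform M (y N - 4 *: avg1 y N + 3 *: avg2 y N))
  <= \sum_(i < N) i.+1%:R * qform M (decr y i).
Proof.
move=> pM N0; have n1 : 1 <= N%:R :> R by rewrite ler1n.
have n0 : 0 < N%:R :> R by rewrite ltr0n.
have := @weighted_summation_ineq2 _ _ M y N (2 * (N%:R + 1) / N%:R)
  (2 * (N%:R + 1) / N%:R * (2 * c3 N%:R)) pM.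
set n' : R := N%:R in n1 n0 *.
have [c3_ge0 c3_le] : 0 <= c3 n' /\ c3 n' * (n' - 1) <= n' + 2.
  rewrite /c3; case: eqVneq => [->|n'1]; first by split; lra.
  have n'gt : 0 < n' - 1 by rewrite subr_gt0 lt_neqAle eq_sym n'1.
  split; first by rewrite divr_ge0; lra.
  by rewrite divfK ?gt_eqF.
have g0 : 0 <= 2 * (n' + 1) / n' by rewrite divr_ge0; lra.
move=> H; rewrite (mulrDr (2 * (n' + 1) / n')) [in leLHS](mulrA _ (2 * c3 n')); apply: H => //.
- by rewrite mulr_ge0 // mulr_ge0.
- by rewrite divfK ?gt_eqF.
- rewrite (_ : _ * _ = 4 * (n' + 1) * (c3 n' * (n' - 1))); last by field; rewrite gt_eqF.
  by rewrite [leRHS]mulrA ler_wpM2l //; lra.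
Qed.

Lemma avg_singleton (y : nat -> 'cV[R]_n) : (avg1 y 0 = y 0%N) * (avg2 y 0 = y 0%N).
Proof.
have T0 : T 0%:R = 1 :> R by rewrite /T add0r.
have gamma0 : gamma 0%:R = 1 :> R by rewrite /gamma /T; field.
by rewrite /avg1 /avg2 !big_ord1 T0 gamma0 invr1 !scale1r.
Qed.

Definition Legendre3 (y : nat -> 'cV[R]_n) N : 'cV[R]_(n + (n + n)) :=
  col3 (y 0%N - y N) (y 0%N + y N - 2 *: avg1 y N)
    (y 0%N - y N + 6 *: avg1 y N - 6 *: avg2 y N).

(** On a segment reduced to one point the endpoints and averages coincide. *)
Lemma Legendre3_singleton y : Legendre3 y 0 = 0.
Proof.
rewrite /Legendre3 !avg_singleton subrr add0r subrr scaler_nat mulr2n subrr /col3.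
by rewrite !col_mx0.
Qed.

(** The coefficients 1, 3, 5 do not depend on [N], unlike the sharp ones: this
    uniformity is needed because the position of the cut between the two
    segments varies with time. *)
Lemma Pi4_segment_bound (M : 'M[R]_n) (y : nat -> 'cV[R]_n) N :
  possemidefmx M ->
  qform (Rtilde2 M) (Legendre3 y N) <= N%:R * \sum_(i < N) qform M (decr y i).
Proof.
case: N => [|N] pM.
  by rewrite Legendre3_singleton mul0r qform_bform bform0r.
rewrite qform_diag3 !qform_mxZ.
have n0 : 0 < N.+1%:R :> R by rewrite ltr0n.
have n1 : 1 <= N.+1%:R :> R by rewrite ler1n.
have := @summation_ineq3 _ _ M y N.+1 N.+1%:R^-1 (3 / N.+1%:R) (5 / N.+1%:R) pM.
move: (N.+1%:R) n0 n1 => n' n0 n1.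
move=> H; apply: le_trans _ (ler_wpM2l (ltW n0) (H _ _ _ _ _ _)).
- by rewrite le_eqVlt; apply/orP; left; apply/eqP; field; rewrite gt_eqF.
- by rewrite invr_ge0 ltW.
- by rewrite divr_ge0 ?ltW.
- by rewrite divr_ge0 ?ltW.
- by rewrite mulVf ?gt_eqF.
- rewrite (_ : _ * _ = 3 * (n' - 1)); last by field; rewrite gt_eqF.
  lra.
- rewrite (_ : _ * _ = 5 * ((n' - 1) * (n' - 2))); last by field; rewrite gt_eqF.
  nra.
Qed.

Lemma Pi6_segment_bound (M : 'M[R]_n) (y : nat -> 'cV[R]_n) N :
  possemidefmx M ->
  2 * qform M (y N - avg1 y N) + 4 * qform M (y N - 4 *: avg1 y N + 3 *: avg2 y N)
  <= \sum_(i < N) i.+1%:R * qform M (decr y i).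
Proof.
move=> pM; have n0 := ler0n R N.
by apply: weighted_summation_ineq2 => //; nra.
Qed.

End SegmentBounds.

(** * The Lyapunov functional and its decrease along one step *)

Section Lyapunov.
Set Implicit Arguments.
Unset Strict Implicit.
Unset Printing Implicit Defensive.
Context {R : realType} (n : nat).
Implicit Types H : nat -> 'cV[R]_n.

(** Sliding a window by one place adds the newest term and drops the oldest. *)
Lemma sum_window_shift (U : zmodType) (f g : nat -> U) N :
  (forall i, g i.+1 = f i) ->
  \sum_(i < N.+1) g i - \sum_(i < N.+1) f i = g 0%N - f N.
Proof.
move=> gf; rewrite big_ord_recl [X in _ - X]big_ord_recr /=.
under eq_bigr => i _ do rewrite gf.
by rewrite opprD addrA addrK.
Qed.

Lemma sum_behead (U : zmodType) N (f : nat -> U) :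
  \sum_(i < N.+1) f i - f 0%N = \sum_(i < N) f i.+1.
Proof. by rewrite big_ord_recl addrC addKr. Qed.

Lemma sum_belast (U : zmodType) N (f : nat -> U) :
  \sum_(i < N.+1) f i - f N = \sum_(i < N) f i.
Proof. by rewrite big_ord_recr addrK. Qed.

Lemma sum_succ N : \sum_(i < N) i.+1%:R = gamma (N%:R - 1) :> R.
Proof.
rewrite /gamma /T; elim: N => [|N IH]; first by rewrite big_ord0; field.
by rewrite big_ord_recr /= IH -natr1; field.
Qed.

Definition segment H a : nat -> 'cV[R]_n := fun i => H (a + i)%N.

(** The blocks are numbered from 1, whence the dummy entry 0. *)
Definition zeta H N0 N1 N2 (i : nat) : 'cV[R]_n :=
  [:: 0; H 0%N; H N0; H (N0 + N1)%N; H (N0 + N1 + N2)%N;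
      avg1 H N0; avg1 (segment H N0) N1; avg1 (segment H (N0 + N1)) N2;
      avg2 H N0; avg2 (segment H N0) N1; avg2 (segment H (N0 + N1)) N2]`_i.

Definition augmented H N0 d : 'cV[R]_(n + (n + (n + n))) :=
  col4 (H 0%N) (\sum_(i < N0) H i.+1) (\sum_(i < d) H (N0 + i).+1)
    (\sum_(i < N0) \sum_(j < i.+1) H j.+1).

Context (P : 'M[R]_(n + (n + (n + n)))) (Q1 Q2 R1 R2 S1 S2 : 'M[R]_n).

(** The increment terms are sums of windows of growing lengths. When time
    advances by one, each window loses its oldest increment, so the outer
    weights ([N0], [d] or [i.+1]) become the weights of the sums of increments to
    which the summation inequalities apply. *)
Definition lyapunov N0 d H : R :=
  qform P (augmented H N0 d)
  + (\sum_(i < N0) qform Q1 (H i.+1) + \sum_(i < d) qform Q2 (H (N0 + i).+1))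
  + \sum_(i < N0) (N0%:R * (\sum_(j < i.+1) qform R1 (decr H j))
                   + i.+1%:R * (\sum_(j < i.+1) qform S1 (decr H j)))
  + \sum_(i < d) (d%:R * (\sum_(j < (N0 + i).+1) qform R2 (decr H j))
                   + i.+1%:R * (\sum_(j < (N0 + i).+1) qform S2 (decr H j))).

Section Step.
Context (H H' : nat -> 'cV[R]_n).
Context (shift : forall i, H' i.+1 = H i).

(** The third block sums the values between the lags [N0] and [N0 + N1 + N2].
    Splitting it at the lag [N0 + N1], the current delay, and expressing the
    pieces by averages is what puts the delay into the coefficients, affinely. *)
Lemma augmented_old N0 N1 N2 :
  augmented H N0 (N1 + N2) =
  col4 (H 0%N) (T N0%:R *: avg1 H N0 - H 0%N)
    (T N1%:R *: avg1 (segment H N0) N1 + T N2%:R *: avg1 (segment H (N0 + N1)) N2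
      - H N0 - H (N0 + N1)%N)
    (gamma N0%:R *: avg2 H N0 - T N0%:R *: H 0%N).
Proof.
rewrite /avg1 /avg2 !scalerA !mulfV ?gt_eqF ?T_gt0 ?gamma_gt0 // !scale1r.
rewrite /augmented; congr col4.
- by rewrite sum_behead.
- have behead a N : \sum_(i < N.+1) segment H a i - H a = \sum_(i < N) segment H a i.+1.
    by rewrite -sum_behead /segment addn0.
  rewrite -addrA addrACA !behead.
  rewrite big_split_ord /=; congr (_ + _); apply: eq_bigr => i _;
    by rewrite /segment ?addnS ?addnA.
- have -> : T N0%:R *: H 0%N = \sum_(i < N0.+1) H 0%N.
    by rewrite /T natr1 scaler_nat sumr_const card_ord.
  rewrite -sumrB.
  under [RHS]eq_bigr => i _ do rewrite sum_behead.
  by rewrite [RHS]big_ord_recl big_ord0 add0r.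
Qed.

(** Seen from [H], the windows of [H'] are those of [augmented_old] moved one place
    towards the present, so the averages are the same and only the endpoints
    removed from them differ. *)
Lemma augmented_new N0 N1 N2 :
  augmented H' N0 (N1 + N2) =
  col4 (H' 0%N) (T N0%:R *: avg1 H N0 - H N0)
    (T N1%:R *: avg1 (segment H N0) N1 + T N2%:R *: avg1 (segment H (N0 + N1)) N2
      - H (N0 + N1)%N - H (N0 + N1 + N2)%N)
    (gamma N0%:R *: avg2 H N0 - T N0%:R *: avg1 H N0).
Proof.
rewrite /avg1 /avg2 !scalerA !mulfV ?gt_eqF ?T_gt0 ?gamma_gt0 // !scale1r.
rewrite /augmented; congr col4.
- by rewrite big_ord_recr addrK; apply: eq_bigr => i _; rewrite shift.
- rewrite -addrA addrACA (sum_belast N1 (segment H N0)).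
  rewrite (sum_belast N2 (segment H (N0 + N1))) big_split_ord /=.
  by congr (_ + _); apply: eq_bigr => i _; rewrite shift /segment ?addnA.
- rewrite big_ord_recr addrK /=; apply: eq_bigr => i _; apply: eq_bigr => j _.
  by rewrite shift.
Qed.

Lemma sumQ_step (q : 'cV[R]_n -> R) N0 d :
  \sum_(i < d) q (H' (N0 + i).+1) - \sum_(i < d) q (H (N0 + i).+1)
  = q (H N0) - q (H (N0 + d)%N).
Proof.
under eq_bigr => i _ do rewrite shift.
elim: d => [|d IH]; first by rewrite !big_ord0 addn0 !subrr.
by rewrite !big_ord_recr /= opprD addrACA IH addnS addrA subrK.
Qed.

Lemma sum_window_step (r s : 'cV[R]_n -> R) N0 d :
  let w K i := d%:R * (\sum_(j < (N0 + i).+1) r (decr K j))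
               + i.+1%:R * (\sum_(j < (N0 + i).+1) s (decr K j)) in
  \sum_(i < d) w H' i - \sum_(i < d) w H i =
  d%:R ^+ 2 * r (H' 0%N - H 0%N) + gamma (d%:R - 1) * s (H' 0%N - H 0%N)
  - d%:R * (\sum_(i < d) r (decr (segment H N0) i))
  - \sum_(i < d) i.+1%:R * s (decr (segment H N0) i).
Proof.
move=> w.
have decrS i : decr H' i.+1 = decr H i by rewrite /decr !shift.
have decr0 : decr H' 0%N = H' 0%N - H 0%N by rewrite /decr shift.
have seg i : decr (segment H N0) i = decr H (N0 + i) by rewrite /decr /segment addnS.
rewrite -sumrB -sum_succ mulr_suml mulr_sumr.
have -> : d%:R ^+ 2 * r (H' 0%N - H 0%N) = \sum_(i < d) d%:R * r (H' 0%N - H 0%N).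
  by rewrite sumr_const card_ord -[RHS]mulr_natl; ring.
rewrite -big_split -!sumrB; apply: eq_bigr => i _; rewrite /w /=.
have E (f : 'cV[R]_n -> R) :
  \sum_(j < (N0 + i).+1) f (decr H' j) =
  \sum_(j < (N0 + i).+1) f (decr H j) + f (H' 0%N - H 0%N) - f (decr (segment H N0) i).
  apply/eqP; rewrite -addrA addrC -subr_eq.
  rewrite (sum_window_shift (f := fun j => f (decr H j)) (g := fun j => f (decr H' j))).
    by rewrite decr0 seg.
  by move=> j; rewrite decrS.
by rewrite !E; ring.
Qed.

End Step.

Context (A Ad : 'M[R]_n) (X : 'M[R]_(n + (n + n))).

(** [N1] and [N2] are the distances of the current delay from the two bounds. The
    sums of increments left by [sum_window_step] are estimated separately on the
    interval up to [N0] and on the two pieces of the interval beyond it. *)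
Lemma lyapunov_step H H' N0 N1 N2 :
  (0 < N0)%N -> P^T = P ->
  possemidefmx R1 -> possemidefmx R2 -> possemidefmx S1 -> possemidefmx S2 ->
  possemidefmx (Rtilde2X R2 X) ->
  (forall i, H' i.+1 = H i) ->
  H' 0%N = A *m H 0%N + Ad *m H (N0 + N1)%N ->
  lyapunov N0 (N1 + N2) H' - lyapunov N0 (N1 + N2) H
  <= qform (Pi A Ad N0%:R (N0 + N1 + N2)%:R P Q1 Q2 R1 R2 S1 S2 X (N0 + N1)%:R)
       (stack (zeta H N0 N1 N2)).
Proof.
move=> N0_gt0 sP pR1 pR2 pS1 pS2 pX shift dyn.
have Edx : calA A Ad *m stack (zeta H N0 N1 N2) = H' 0%N - H 0%N.
  by rewrite /calA mulmxDl -!mulmxA !e_stack //= mulmxBl mul1mx dyn addrAC.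
rewrite qform_Pi // Edx !e_stack //= [H 0%N + _]addrC subrK.
have e1 : (N0 + N1)%:R - N0%:R = N1%:R :> R by rewrite natrD addrC addKr.
have e2 : (N0 + N1 + N2)%:R - (N0 + N1)%:R = N2%:R :> R by rewrite natrD addrC addKr.
have e3 : (N0 + N1 + N2)%:R - N0%:R = (N1 + N2)%:R :> R by rewrite -addnA natrD addrC addKr.
rewrite e1 e2 e3 -(augmented_old H) -(augmented_new shift).
have dQ1 : \sum_(i < N0) qform Q1 (H' i.+1) - \sum_(i < N0) qform Q1 (H i.+1)
    = qform Q1 (H 0%N) - qform Q1 (H N0).
  exact: (sumQ_step shift (qform Q1) 0 N0).
have dQ2 := sumQ_step shift (qform Q2) N0 (N1 + N2).
have dW1 : let w K i := N0%:R * (\sum_(j < i.+1) qform R1 (decr K j))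
      + i.+1%:R * (\sum_(j < i.+1) qform S1 (decr K j)) in
    \sum_(i < N0) w H' i - \sum_(i < N0) w H i =
    N0%:R ^+ 2 * qform R1 (H' 0%N - H 0%N) + gamma (N0%:R - 1) * qform S1 (H' 0%N - H 0%N)
    - N0%:R * (\sum_(i < N0) qform R1 (decr H i))
    - \sum_(i < N0) i.+1%:R * qform S1 (decr H i).
  exact: (sum_window_step shift (qform R1) (qform S1) 0 N0).
have dW2 := sum_window_step shift (qform R2) (qform S2) N0 (N1 + N2).
have B3 := Pi3_bound H pR1 N0_gt0.
have B5 := Pi5_bound H pS1 N0_gt0.
have split_seg (f : 'cV[R]_n -> R) (w : nat -> R) :
    \sum_(i < N1 + N2) w i * f (decr (segment H N0) i)
    = \sum_(i < N1) w i * f (decr (segment H N0) i)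
      + \sum_(i < N2) w (N1 + i)%N * f (decr (segment H (N0 + N1)) i).
  rewrite big_split_ord; congr (_ + _); apply: eq_bigr => i _.
  by rewrite /decr /segment /= !addnS !addnA.
have B4 : qform (Rtilde2X R2 X) (col_mx (Legendre3 (segment H N0) N1)
      (Legendre3 (segment H (N0 + N1)) N2))
    <= (N1 + N2)%:R * \sum_(i < N1 + N2) qform R2 (decr (segment H N0) i).
  have := split_seg (qform R2) (fun=> 1).
  under eq_bigr do rewrite mul1r.
  under [in RHS]eq_bigr do rewrite mul1r.
  under [in X in _ = _ + X]eq_bigr do rewrite mul1r.
  move=> ->; apply: reciprocally_convex => //.
  - by move=> ->; exact: Legendre3_singleton.
  - by move=> ->; exact: Legendre3_singleton.
  - by rewrite sumr_ge0 // => i _; case: pR2.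
  - by rewrite sumr_ge0 // => i _; case: pR2.
  - exact: Pi4_segment_bound.
  - exact: Pi4_segment_bound.
have B6 : 2 * (qform S2 (H (N0 + N1)%N - avg1 (segment H N0) N1)
    + qform S2 (H (N0 + N1 + N2)%N - avg1 (segment H (N0 + N1)) N2))
  + 4 * (qform S2 (H (N0 + N1)%N - 4 *: avg1 (segment H N0) N1
                   + 3 *: avg2 (segment H N0) N1)
    + qform S2 (H (N0 + N1 + N2)%N - 4 *: avg1 (segment H (N0 + N1)) N2
                + 3 *: avg2 (segment H (N0 + N1)) N2))
  <= \sum_(i < N1 + N2) i.+1%:R * qform S2 (decr (segment H N0) i).
  rewrite (split_seg (qform S2) (fun i => i.+1%:R)).
  have b1 := Pi6_segment_bound (segment H N0) N1 pS2.
  have b2 := Pi6_segment_bound (segment H (N0 + N1)) N2 pS2.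
  (* On the second piece the weight restarts from 1, losing N1 on each term. *)
  have b3 : \sum_(i < N2) i.+1%:R * qform S2 (decr (segment H (N0 + N1)) i)
      <= \sum_(i < N2) (N1 + i).+1%:R * qform S2 (decr (segment H (N0 + N1)) i).
    apply: ler_sum => i _; rewrite ler_wpM2r ?ler_nat ?ltnS ?leq_addl //.
    by case: pS2.
  move: b1 b2; rewrite {1 2}/segment {3 4}/segment; lra.
move: dQ1 dQ2 dW1 dW2 B3 B4 B5 B6.
rewrite /lyapunov /zeta /Legendre3 /segment /= !addn0 !addnA.
move=> dQ1 dQ2 dW1 dW2 B3 B4 B5 B6.
have -> (a b c d a' b' c' d' : R) :
    a' + b' + c' + d' - (a + b + c + d) = (a' - a) + (b' - b) + (c' - c) + (d' - d).
  by ring.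
rewrite dW1 dW2.
move: dQ1 dQ2 B3 B4 B5 B6 {dW1 dW2}.
lra.
Qed.
End Lyapunov.

(** * Growth of the functional *)

Section Growth.
Set Implicit Arguments.
Unset Strict Implicit.
Unset Printing Implicit Defensive.
Context {R : realType} (n K : nat).
Implicit Types H : nat -> 'cV[R]_n.

(** [K] is the largest lag on which the functionals below depend; [rho] bounds
    the history up to it. *)
Definition window_le H (rho : R) := 0 <= rho /\ forall j, (j <= K)%N -> `|H j| <= rho.

Definition linear_growth m (F : (nat -> 'cV[R]_n) -> 'cV[R]_m) :=
  exists2 C, 0 <= C & forall H rho, window_le H rho -> `|F H| <= C * rho.

Definition quadratic_growth (G : (nat -> 'cV[R]_n) -> R) :=
  exists2 C, 0 <= C & forall H rho, window_le H rho -> G H <= C * rho ^+ 2.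

Lemma linear_growth_proj j : (j <= K)%N -> linear_growth (fun H => H j).
Proof. by move=> jK; exists 1 => // H rho [_ Hrho]; rewrite mul1r Hrho. Qed.

Lemma linear_growthB m (F G : (nat -> 'cV[R]_n) -> 'cV[R]_m) :
  linear_growth F -> linear_growth G -> linear_growth (fun H => F H - G H).
Proof.
move=> [C C0 HF] [D D0 HG]; exists (C + D) => [|H rho Hrho]; first exact: addr_ge0.
by rewrite mulrDl (le_trans (ler_normB _ _)) // lerD ?HF ?HG.
Qed.

Lemma linear_growth_sum m I (r : seq I) (F : I -> (nat -> 'cV[R]_n) -> 'cV[R]_m) :
  (forall i, linear_growth (F i)) -> linear_growth (fun H => \sum_(i <- r) F i H).
Proof.
move=> HF; elim: r => [|i r [C C0 HC]].
  by exists 0 => // H rho _; rewrite big_nil normr0 mul0r.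
have [D D0 HD] := HF i.
exists (D + C) => [|H rho Hrho]; first exact: addr_ge0.
rewrite big_cons; by rewrite mulrDl (le_trans (ler_normD _ _)) // lerD ?HC ?HD.
Qed.

Lemma linear_growth_col m1 m2 (F : (nat -> 'cV[R]_n) -> 'cV[R]_m1)
    (G : (nat -> 'cV[R]_n) -> 'cV[R]_m2) :
  linear_growth F -> linear_growth G -> linear_growth (fun H => col_mx (F H) (G H)).
Proof.
move=> [C C0 HF] [D D0 HG]; exists (C + D) => [|H rho Hrho]; first exact: addr_ge0.
have rho0 := Hrho.1.
apply: mx_norm_le => [|i j]; first by rewrite mulr_ge0 ?addr_ge0.
rewrite mxE mulrDl; case: splitP => k _.
- by rewrite (le_trans (mx_entry_le _ _ _)) // (le_trans (HF _ _ Hrho)) // lerDl mulr_ge0.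
- by rewrite (le_trans (mx_entry_le _ _ _)) // (le_trans (HG _ _ Hrho)) // lerDr mulr_ge0.
Qed.

Lemma qform_le m (M : 'M[R]_m) :
  exists2 C, 0 <= C & forall v, qform M v <= C * `|v| ^+ 2.
Proof.
exists (\sum_j \sum_i `|M i j|) => [|v]; first by rewrite !sumr_ge0 // => *; rewrite sumr_ge0.
rewrite /qform mxE mulr_suml; apply: ler_sum => j _.
rewrite mxE !mulr_suml; apply: ler_sum => i _; rewrite mxE.
apply: le_trans (ler_norm _) _; rewrite !normrM expr2 mulrA ler_pM ?mulr_ge0 //.
- by rewrite mulrC ler_wpM2l // mx_entry_le.
- exact: mx_entry_le.
Qed.

Lemma quadratic_growth_qform m (M : 'M[R]_m) F :
  linear_growth F -> quadratic_growth (fun H => qform M (F H)).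
Proof.
move=> [C C0 HF]; have [D D0 HD] := qform_le M.
exists (D * C ^+ 2) => [|H rho Hrho]; first by rewrite mulr_ge0 ?sqr_ge0.
apply: le_trans (HD _) _; rewrite -mulrA -exprMn ler_wpM2l //.
by rewrite ler_sqr ?nnegrE ?normr_ge0 ?mulr_ge0 ?HF // Hrho.1.
Qed.

Lemma quadratic_growthD F G :
  quadratic_growth F -> quadratic_growth G -> quadratic_growth (fun H => F H + G H).
Proof.
move=> [C C0 HF] [D D0 HG]; exists (C + D) => [|H rho Hrho]; first exact: addr_ge0.
by rewrite mulrDl lerD ?HF ?HG.
Qed.

Lemma quadratic_growthZ a F :
  0 <= a -> quadratic_growth F -> quadratic_growth (fun H => a * F H).
Proof.
move=> a0 [C C0 HF]; exists (a * C) => [|H rho Hrho]; first exact: mulr_ge0.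
by rewrite -mulrA ler_wpM2l ?HF.
Qed.

Lemma quadratic_growth_sum I (r : seq I) (F : I -> (nat -> 'cV[R]_n) -> R) :
  (forall i, quadratic_growth (F i)) -> quadratic_growth (fun H => \sum_(i <- r) F i H).
Proof.
move=> HF; elim: r => [|i r [C C0 HC]].
  by exists 0 => // H rho _; rewrite big_nil mul0r.
have [D D0 HD] := HF i.
exists (D + C) => [|H rho Hrho]; first exact: addr_ge0.
rewrite big_cons; by rewrite mulrDl lerD ?HC ?HD.
Qed.

End Growth.

Section LyapunovBounds.
Set Implicit Arguments.
Unset Strict Implicit.
Unset Printing Implicit Defensive.
Context {R : realType} (n : nat).
Context (P : 'M[R]_(n + (n + (n + n)))) (Q1 Q2 R1 R2 S1 S2 : 'M[R]_n) (N0 d : nat).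
Local Notation V := (lyapunov P Q1 Q2 R1 R2 S1 S2 N0 d).

Lemma lyapunov_growth : quadratic_growth (N0 + d) V.
Proof.
have pt j : (j <= N0 + d)%N -> linear_growth (N0 + d) (fun H : nat -> 'cV[R]_n => H j).
  exact: linear_growth_proj.
have dec (M : 'M[R]_n) j : (j.+1 <= N0 + d)%N ->
    quadratic_growth (N0 + d) (fun H => qform M (decr H j)).
  by move=> jK; apply/quadratic_growth_qform/linear_growthB; apply: pt; lia.
rewrite /lyapunov; apply: quadratic_growthD; last first.
- apply: quadratic_growth_sum => i; have iN := ltn_ord i; apply: quadratic_growthD;
    apply: quadratic_growthZ; rewrite ?ler0n //;
    apply: quadratic_growth_sum => j; have jN := ltn_ord j; apply: dec; lia.
apply: quadratic_growthD; last first.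
- apply: quadratic_growth_sum => i; have iN := ltn_ord i; apply: quadratic_growthD;
    apply: quadratic_growthZ; rewrite ?ler0n //;
    apply: quadratic_growth_sum => j; have jN := ltn_ord j; apply: dec; lia.
apply: quadratic_growthD.
- apply: quadratic_growth_qform; apply: linear_growth_col; first exact: pt.
  apply: linear_growth_col.
    by apply: linear_growth_sum => i; have iN := ltn_ord i; apply: pt; lia.
  apply: linear_growth_col.
    by apply: linear_growth_sum => i; have iN := ltn_ord i; apply: pt; lia.
  apply: linear_growth_sum => i; have iN := ltn_ord i.
  apply: linear_growth_sum => j; have jN := ltn_ord j; apply: pt; lia.
- by apply: quadratic_growthD; apply: quadratic_growth_sum => i; have iN := ltn_ord i;
    apply: quadratic_growth_qform; apply: pt; lia.
Qed.

Lemma lyapunov_ge H :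
  possemidefmx Q1 -> possemidefmx Q2 -> possemidefmx R1 -> possemidefmx R2 ->
  possemidefmx S1 -> possemidefmx S2 ->
  qform P (augmented H N0 d) <= V H.
Proof.
move=> [_ q1] [_ q2] [_ r1] [_ r2] [_ s1] [_ s2].
rewrite /lyapunov -!addrA lerDl !addr_ge0 ?sumr_ge0 // => i _;
  by rewrite addr_ge0 ?mulr_ge0 ?sumr_ge0.
Qed.

End LyapunovBounds.

(** * From the functional to stability *)

Section Stability.
Set Implicit Arguments.
Unset Strict Implicit.
Unset Printing Implicit Defensive.
Local Open Scope classical_set_scope.
Context {R : realType} (n : nat).

Definition history (x : int -> 'cV[R]_n) (k : nat) : nat -> 'cV[R]_n :=
  fun j => x (k%:Z - j%:Z).

Lemma historyS x k j : history x k.+1 j.+1 = history x k j.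
Proof. by rewrite /history; congr x; lia. Qed.

Lemma history0 x k : history x k 0 = x k%:Z.
Proof. by rewrite /history subr0. Qed.

(** The value of [V] at the initial history bounds every later state, because [V]
    never increases along a solution. Being nonnegative too, [V] converges, so its
    decrements, which dominate the squared norm of the state, tend to 0. *)
Lemma lyapunov_criterion (A Ad : 'M[R]_n) (h2 : nat) (h : nat -> nat)
    (V : (nat -> 'cV[R]_n) -> R) (C : R) :
  0 < C -> quadratic_growth h2 V ->
  (forall H, `|H 0%N| ^+ 2 <= C * V H) ->
  (forall phi x, is_solution A Ad h2 h phi x -> forall k,
     `|x k%:Z| ^+ 2 <= C * (V (history x k) - V (history x k.+1))) ->
  asymptotically_stable A Ad h2 h.
Proof.
move=> C0 [D D0 VD] Vlow Vdecr.
have V0 H : 0 <= V H.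
  by rewrite -(pmulr_rge0 _ C0) (le_trans _ (Vlow H)) ?sqr_ge0.
have dec phi x : is_solution A Ad h2 h phi x ->
    forall k, V (history x k.+1) <= V (history x k).
  move=> sol k; rewrite -subr_ge0 -(pmulr_rge0 _ C0).
  by rewrite (le_trans _ (Vdecr _ _ sol k)) ?sqr_ge0.
have decr0 phi x : is_solution A Ad h2 h phi x ->
    forall k, V (history x k) <= V (history x 0).
  by move=> sol; elim=> [//|k IH]; exact: le_trans (dec _ _ sol k) IH.
split.
  move=> eps eps0; pose K := C * D; have K0 : 0 <= K by rewrite mulr_ge0 // ltW.
  (* Then K * delta^2 < eps^2, as K < (K + 1)^2. *)
  exists (eps / (K + 1)) => [|phi x sol small k]; first by rewrite divr_gt0 // ltr_wpDl.
  set delta := eps / (K + 1).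
  have delta0 : 0 < delta by rewrite divr_gt0 // ltr_wpDl.
  have win : window_le h2 (history x 0) delta.
    split=> [|j jh2]; first exact: ltW.
    have jr : - h2%:Z <= 0 - j%:Z <= 0 by lia.
    by rewrite /history sol.1 // ltW // small.
  have xk : `|x k%:Z| ^+ 2 <= K * delta ^+ 2.
    rewrite -history0 (le_trans (Vlow _)) // -mulrA ler_pM2l //.
    by rewrite (le_trans (decr0 _ _ sol k)) // VD.
  rewrite -ltr_sqr ?nnegrE ?(ltW eps0) // (le_lt_trans xk) //.
  have -> : eps = delta * (K + 1) by rewrite /delta divfK // gt_eqF // ltr_wpDl.
  move: (delta) (K) delta0 K0 => a b a0 b0.
  by rewrite exprMn mulrC ltr_pM2l ?exprn_gt0 //; nra.
exists 1 => // phi x sol _.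
apply/cvgr0Pnorm_lt => eps eps0.
have cvgV : cvgn (fun k => V (history x k)).
  apply: nonincreasing_is_cvgn.
    by apply/nonincreasing_seqP => k; exact: dec sol k.
  by exists 0 => _ [k _ <-].
have cvgdV : (fun k => V (history x k) - V (history x k.+1)) @ \oo --> (0 : R).
  rewrite -(subrr (limn (fun k => V (history x k)))).
  by apply: cvgB; [|rewrite (cvg_shiftS (fun k => V (history x k)))].
have e0 : 0 < eps ^+ 2 / C by rewrite divr_gt0 ?exprn_gt0.
have /cvgr0Pnorm_lt/(_ _ e0) := cvgdV.
apply: filterS => k Hk; rewrite -ltr_sqr ?nnegrE ?(ltW eps0) //.
apply: le_lt_trans (Vdecr _ _ sol k) _.
by rewrite mulrC -ltr_pdivlMr // (le_lt_trans (ler_norm _)).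
Qed.

(** For [q1], [q2] the values at one vector of the forms of the two extreme
    delays: each is at most [- w / C] with [C = C0 + C1 + C2], hence so is their
    convex combination [q]. *)
Lemma convex_decrease (C0 C1 C2 t q1 q2 q w s : R) :
  0 < C0 -> 0 < C1 -> 0 < C2 -> 0 <= t <= 1 -> 0 <= w ->
  w <= C1 * - q1 -> w <= C2 * - q2 -> q = (1 - t) * q1 + t * q2 -> s <= q ->
  w <= (C0 + C1 + C2) * - s.
Proof.
move=> C00 C10 C20 /andP[t0 t1] w0 w1 w2 -> sq.
have q1_le0 : 0 <= - q1 by rewrite -(pmulr_rge0 _ C10) (le_trans w0).
have q2_le0 : 0 <= - q2 by rewrite -(pmulr_rge0 _ C20) (le_trans w0).
have le1 : w <= (C0 + C1 + C2) * - q1 by nra.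
have le2 : w <= (C0 + C1 + C2) * - q2 by nra.
have le3 : (C0 + C1 + C2) * s <= (C0 + C1 + C2) * ((1 - t) * q1 + t * q2).
  by rewrite ler_wpM2l // !addr_ge0 ?ltW.
move: (C0 + C1 + C2) le1 le2 le3 => C le1 le2 le3.
have : (1 - t) * w <= (1 - t) * (C * - q1) by rewrite ler_wpM2l ?subr_ge0.
have : t * w <= t * (C * - q2) by rewrite ler_wpM2l.
lra.
Qed.

End Stability.

Theorem theorem1 (R : realType) (n : nat) (A Ad : 'M[R]_n) (h1 h2 : nat)
    (n_gt0 : (0 < n)%N) (h1_gt0 : (0 < h1)%N) (le_h12 : (h1 <= h2)%N)
    (LMI : exists (P : 'M[R]_(n + (n + (n + n))))
                  (Q1 Q2 R1 R2 S1 S2 : 'M[R]_n) (X : 'M[R]_(n + (n + n))),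
        posdefmx P /\
        [/\ posdefmx Q1 & posdefmx Q2] /\
        [/\ posdefmx R1 & posdefmx R2] /\
        [/\ posdefmx S1 & posdefmx S2] /\
        possemidefmx (Rtilde2X R2 X) /\
        negdefmx (Pi A Ad h1%:R h2%:R P Q1 Q2 R1 R2 S1 S2 X h1%:R) /\
        negdefmx (Pi A Ad h1%:R h2%:R P Q1 Q2 R1 R2 S1 S2 X h2%:R))
    (h : nat -> nat) (h_bounds : forall k : nat, (h1 <= h k <= h2)%N) :
  asymptotically_stable A Ad h2 h.
Proof.
case: LMI => P [Q1 [Q2 [R1 [R2 [S1 [S2 [X [pP [[pQ1 pQ2] [[pR1 pR2] [[pS1 pS2]]]]]]]]]]]].
move=> [pX [nPi1 nPi2]].
have [C0 C0_gt0 HC0] := posdef_norm_bound (col_mx 1%:M 0)^T pP.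
have [C1 C1_gt0 HC1] := posdef_norm_bound (e R n 1) (negdef_opp nPi1).
have [C2 C2_gt0 HC2] := posdef_norm_bound (e R n 1) (negdef_opp nPi2).
pose V := lyapunov P Q1 Q2 R1 R2 S1 S2 h1 (h2 - h1).
have C_gt0 : 0 < C0 + C1 + C2 by rewrite !addr_gt0.
have V_ge H : qform P (augmented H h1 (h2 - h1)) <= V H.
  by apply: lyapunov_ge; apply: posdef_psd.
have qP_ge0 v : 0 <= qform P v by have [_] := posdef_psd pP; exact.
apply: (lyapunov_criterion (V := V) C_gt0).
- by have := lyapunov_growth P Q1 Q2 R1 R2 S1 S2 h1 (h2 - h1); rewrite subnKC.
- move=> H; have := HC0 (augmented H h1 (h2 - h1)).
  rewrite tr_col_mx mul_row_col trmx1 mul1mx trmx0 mul0mx addr0 => /le_trans; apply.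
  have V0 := le_trans (qP_ge0 _) (V_ge H).
  rewrite (le_trans (ler_wpM2l (ltW C0_gt0) (V_ge H))) // ler_wpM2r //; lra.
move=> phi x [_ dyn] k.
have /andP[h1k kh2] := h_bounds k.
pose N1 := (h k - h1)%N; pose N2 := (h2 - h k)%N.
have e1 : (h1 + N1)%N = h k by rewrite subnKC.
have e2 : (h1 + N1 + N2)%N = h2 by rewrite e1 subnKC.
have e3 : (h2 - h1)%N = (N1 + N2)%N by rewrite /N1 /N2; lia.
pose z := stack (zeta (history x k) h1 N1 N2).
have step : V (history x k.+1) - V (history x k)
    <= qform (Pi A Ad h1%:R h2%:R P Q1 Q2 R1 R2 S1 S2 X (h k)%:R) z.
  have := @lyapunov_step _ _ P Q1 Q2 R1 R2 S1 S2 A Ad X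
    (history x k) (history x k.+1) h1 N1 N2 h1_gt0 (symmx_tr pP.1).
  rewrite e2 e1 /V e3; apply; try exact: posdef_psd; try exact: pX.
    by move=> i; rewrite historyS.
  by rewrite !history0 -dyn; congr x; lia.
have [t [t01 ht]] : exists t : R, 0 <= t <= 1 /\ (h k)%:R = (1 - t) * h1%:R + t * h2%:R.
  have [h12|h12] := eqVneq h1 h2.
    exists 0; split; first by rewrite lexx ler01.
    by rewrite subr0 mul1r mul0r addr0; congr _%:R; lia.
  have d0 : 0 < h2%:R - h1%:R :> R by rewrite subr_gt0 ltr_nat; lia.
  exists (((h k)%:R - h1%:R) / (h2%:R - h1%:R)); split.
    rewrite divr_ge0 ?ler_pdivrMr ?mul1r ?subr_ge0 ?ler_nat ?(ltW d0) //=.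
    by rewrite lerB // ler_nat.
  by field; rewrite gt_eqF.
have bound1 := HC1 z; have bound2 := HC2 z.
rewrite qform_mxN e_stack // /zeta /= history0 in bound1.
rewrite qform_mxN e_stack // /zeta /= history0 in bound2.
rewrite -[V _ - V _]opprB; rewrite ht in step.
apply: (convex_decrease C0_gt0 C1_gt0 C2_gt0 t01 _ bound1 bound2 _ step).
  exact: sqr_ge0.
exact: qform_Pi_convex.
Qed.
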